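(* Let $G=(V,E)$ be a finite undirected graph (multiple edges and loops allowed), let $K$ be a field of characteristic zero, and fix a linear ordering of $E$. Then: 1. The dimension $\dim_K \mathcal{C}_+(G)$ of the algebra $\mathcal{C}_+(G)$ is equal to the number of spanning odd-circle pseudoforests in $G$, i.e. $$\dim_K \mathcal{C}_+(G)=|\mathcal{P}_+(G)|.$$ 2. For every integer $k\ge 0$, the dimension $\dim_K \mathcal{C}_+^k(G)$ of the $k$-th graded component of $\mathcal{C}_+(G)$ is equal to the number of odd-circle pseudoforests $F\subseteq E$ whose even activity equals $|E\setminus F|-k$, i.e. $$\dim_K \mathcal{C}_+^k(G)=\bigl|\{F\in\mathcal{P}_+(G)\;:\;\mathrm{act}_+(F)=|E\setminus F|-k\}\bigr|.$$
   Context: **Algebra.** Let $B(E)=K[x_e : e\in E]/(x_e^2 : e\in E)$, graded with each $x_e$ in degree $1$. For $v\in V$ and $e\in E$ set $a_{v,e}=1$ if the edge $e$ contains the vertex $v$ (including the case that $e$ is a loop at $v$), and $a_{v,e}=0$ otherwise. Put $y_v=\sum_{e\in E}a_{v,e}x_e\in B(E)$. The algebra $\mathcal{C}_+(G)$ is the (unital) graded $K$-subalgebra of $B(E)$ generated by the elements $y_v$, $v\in V$; $\mathcal{C}_+^k(G)$ is its degree-$k$ component. **Cycles.** A loop is a cycle of length $1$ and a pair of parallel edges is a cycle of length $2$. **Odd-circle pseudoforests.** A unicycle is a connected graph containing a unique cycle (i.e. a connected graph obtained from a tree by adding exactly one edge connecting some of its vertices). A subset $F\subseteq E$ is an odd-circle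 pseudoforest if every connected component of the subgraph with edge set $F$ is either a tree or a unicycle whose cycle has odd length. (Vertices not covered by $F$ are regarded as trees, so $F$ is identified with a spanning subgraph; $F=\emptyset$ is allowed.) $\mathcal{P}_+(G)$ denotes the set of all odd-circle pseudoforests $F\subseteq E$ in $G$. **Even circuits.** A connected graph is called an even circuit if it is one of: (a) a cycle of even length; (b) a union of two odd cycles sharing exactly one vertex (and no edges); (c) a union of two vertex-disjoint odd cycles together with a connecting path (the bridge) of length at least one that joins a vertex of one cycle to a vertex of the other and meets the two cycles only at its endpoints. **Even activity.** For $F\in\mathcal{P}_+(G)$, an edge $e\in E\setminus F$ is evenly active for $F$ if $F\cup\{e\}$ contains an even circuit in which $e$ is the smallest edge with respect to the chosen ordering of $E$. The even activity $\mathrm{act}_+(F)$ is the number of edges that are evenly active for $F$. *)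

(* Defs.v *)
From HB Require Import structures.
From mathcomp Require Import all_boot all_order all_algebra all_field.
From mathcomp Require Import mpoly.
From mathcomp.classical Require Import boolp.

Set Implicit Arguments.
Unset Strict Implicit.
Unset Printing Implicit Defensive.

Import Order.TTheory GRing.Theory.

Local Open Scope ring_scope.
Local Open Scope quotient_scope.

(* K[x_e : e in E] is {mpoly K[#|E|]}, the variable x_e being the one whose
   index is the rank of e in the enumeration of E. *)
Definition mvar (K : fieldType) (E : finType) (e : E) : {mpoly K[#|E|]} :=
  'X_(enum_rank e).

Definition sq_ideal (K : fieldType) (E : finType) : pred {mpoly K[#|E|]} :=
  fun p => `[< exists q : E -> {mpoly K[#|E|]},
                 p = \sum_(e : E) q e * mvar K e ^+ 2 >].
Arguments sq_ideal K E _ : clear implicits.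

Section SquareIdeal.
Variables (K : fieldType) (E : finType).
Implicit Types (p q : {mpoly K[#|E|]}) (m : 'X_{1..#|E|}).

Lemma sq_idealP p :
  reflect (exists q : E -> {mpoly K[#|E|]},
             p = \sum_(e : E) q e * mvar K e ^+ 2)
          (p \in sq_ideal K E).
Proof. by apply: (iffP (asboolP _)). Qed.

Lemma mcoeff_mulX2 p m (e : E) :
  (m (enum_rank e) <= 1)%N -> (p * mvar K e ^+ 2)@_m = 0.
Proof.
move=> le_m; rewrite mcoeffM big1 // => k /eqP Dm.
rewrite /mvar mcoeffXn; case: eqP => [Dk|]; last by rewrite mulr0.
have /mnmP/(_ (enum_rank e)) := Dm; rewrite mnmDE -Dk mulmnE mnm1E eqxx.
by move=> Dme; rewrite Dme mul1n addn2 in le_m.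
Qed.

Lemma sq_ideal_mcoeff p m :
  p \in sq_ideal K E -> (forall i, m i <= 1)%N -> p@_m = 0.
Proof.
case/sq_idealP=> q -> le_m; rewrite raddf_sum big1 // => e _.
exact: mcoeff_mulX2.
Qed.

Lemma sq_ideal_idealr : idealr_closed (sq_ideal K E).
Proof.
split.
- by apply/sq_idealP; exists (fun=> 0); rewrite big1 // => e _; rewrite mul0r.
- apply/negP=> I1; have /eqP: (1 : {mpoly K[#|E|]})@_0%MM = 0.
    by apply: sq_ideal_mcoeff => // i; rewrite mnm0E.
  by rewrite mcoeff1 eqxx oner_eq0.
move=> a p q /sq_idealP[u ->] /sq_idealP[v ->]; apply/sq_idealP.
exists (fun e => a * u e + v e); rewrite mulr_sumr -big_split /=.
by apply: eq_bigr => e _; rewrite mulrDl mulrA.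
Qed.

End SquareIdeal.

HB.instance Definition _ (K : fieldType) (E : finType) :=
  isIdealr.Build {mpoly K[#|E|]} (sq_ideal K E) (@sq_ideal_idealr K E).

Definition sq_idealr (K : fieldType) (E : finType) : idealr {mpoly K[#|E|]} :=
  Idealr.clone _ (sq_ideal K E) _.

(* B(E) = K[x_e : e in E] / (x_e^2 : e in E). *)
Definition sq_alg (K : fieldType) (E : finType) : Type :=
  {ideal_quot (sq_idealr K E)}.

HB.instance Definition _ (K : fieldType) (E : finType) :=
  GRing.ComNzRing.on (sq_alg K E).

Definition sq_pi (K : fieldType) (E : finType) (p : {mpoly K[#|E|]}) :
  sq_alg K E := \pi_({ideal_quot (sq_idealr K E)}) p.

Section SquareAlgebra.
Variables (K : fieldType) (E : finType).
Local Notation B := (sq_alg K E).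
Local Notation pi := (@sq_pi K E).

Lemma sq_pi_zmod_morphism : zmod_morphism pi.
Proof. exact: rmorphB. Qed.

Lemma sq_pi_monoid_morphism : monoid_morphism pi.
Proof. by split; [exact: rmorph1 | exact: rmorphM]. Qed.

HB.instance Definition _ :=
  GRing.isZmodMorphism.Build {mpoly K[#|E|]} B pi sq_pi_zmod_morphism.
HB.instance Definition _ :=
  GRing.isMonoidMorphism.Build {mpoly K[#|E|]} B pi sq_pi_monoid_morphism.

Lemma sq_pi_surj (u : B) : exists p, u = pi p.
Proof. by exists (repr (u : {ideal_quot (sq_idealr K E)})); rewrite /sq_pi reprK. Qed.

Lemma sq_pi_eq0 p : (pi p == 0) = (p \in sq_ideal K E).
Proof.
rewrite -(rmorph0 pi) -[p in RHS]subr0.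
exact/esym/(@Quotient.idealrBE _ (sq_idealr K E) p 0).
Qed.

Definition sq_scale (a : K) (u : B) : B := pi a%:MP * u.

Fact sq_scaleA a b u : sq_scale a (sq_scale b u) = sq_scale (a * b) u.
Proof. by rewrite /sq_scale mulrA -rmorphM mpolyCM. Qed.
Fact sq_scale1 : left_id 1 sq_scale.
Proof. by move=> u; rewrite /sq_scale mpolyC1 rmorph1 mul1r. Qed.
Fact sq_scaleDr : right_distributive sq_scale +%R.
Proof. by move=> a u v; rewrite /sq_scale mulrDr. Qed.
Fact sq_scaleDl u : {morph sq_scale^~ u : a b / a + b}.
Proof. by move=> a b; rewrite /sq_scale mpolyCD rmorphD mulrDl. Qed.

HB.instance Definition _ := GRing.Zmodule_isLmodule.Build K B
  sq_scaleA sq_scale1 sq_scaleDr sq_scaleDl.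

Fact sq_scaleAl (a : K) (u v : B) : a *: (u * v) = a *: u * v.
Proof. by rewrite -[LHS]/(pi _ * _) mulrA. Qed.

HB.instance Definition _ := GRing.Lmodule_isLalgebra.Build K B sq_scaleAl.

Fact sq_scaleAr (a : K) (u v : B) : a *: (u * v) = u * (a *: v).
Proof. by rewrite mulrC sq_scaleAl mulrC. Qed.

HB.instance Definition _ := GRing.Lalgebra_isAlgebra.Build K B sq_scaleAr.

Fact sq_pi_scalable : scalable pi.
Proof. by move=> a p; rewrite -mul_mpolyC rmorphM. Qed.

HB.instance Definition _ :=
  GRing.isScalable.Build K {mpoly K[#|E|]} B *:%R pi sq_pi_scalable.

(* The squarefree monomials are a basis of B(E): this gives finite
   dimensionality. *)
Definition sq_mnm (A : {set E}) : 'X_{1..#|E|} :=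
  [multinom (enum_val i \in A : nat) | i < #|E|].

Lemma sq_mnm_le1 A i : (sq_mnm A i <= 1)%N.
Proof. by rewrite mnmE leq_b1. Qed.

Lemma sq_mnm_inj : injective sq_mnm.
Proof.
move=> A1 A2 /mnmP eqA; apply/setP=> e.
by have:= eqA (enum_rank e); rewrite !mnmE enum_rankK; do 2!case: (_ \in _).
Qed.

Lemma sq_ideal_msupp p :
  (forall A, p@_(sq_mnm A) = 0) -> p \in sq_ideal K E.
Proof.
move=> p0; rewrite [p]mpolyE big_seq -sq_pi_eq0 rmorph_sum big1 //= => m.
rewrite mcoeff_msupp => nz_pm; rewrite linearZ /=.
suffices /eqP->: pi 'X_[m] == 0 by rewrite scaler0.
have [le_m|] := boolP [forall i, m i <= 1]%N.
  case/eqP: nz_pm; suffices ->: m = sq_mnm [set e | m (enum_rank e) == 1%N] by [].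
  apply/mnmP=> i; rewrite mnmE inE enum_valK.
  by have := forallP le_m i; case: (m i) => [|[]].
rewrite negb_forall => /existsP[i]; rewrite -ltnNge => lt1m.
rewrite sq_pi_eq0; apply/sq_idealP.
exists (fun e => (e == enum_val i)%:R * 'X_[(m - U_(i) *+ 2)%MM]).
rewrite (bigD1 (enum_val i)) //= big1 ?addr0 => [|e /negPf->]; last first.
  by rewrite !mul0r.
rewrite eqxx mul1r /mvar enum_valK mpolyXn -mpolyXD submK //.
apply/mnm_lepP=> j; rewrite mulmnE mnm1E.
by case: eqP => [<-|]; rewrite ?mul1n ?mul0n.
Qed.

Definition sq_coord (u : B) : 'rV[K]_#|{set E}| :=
  \row_i (repr (u : {ideal_quot (sq_idealr K E)}))@_(sq_mnm (enum_val i)).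

Lemma sq_coord_pi p i : sq_coord (pi p) 0 i = p@_(sq_mnm (enum_val i)).
Proof.
rewrite mxE; apply/eqP; rewrite -subr_eq0 -mcoeffB; apply/eqP.
apply: sq_ideal_mcoeff (sq_mnm_le1 _).
by rewrite -sq_pi_eq0 rmorphB /= /sq_pi reprK subrr.
Qed.

Fact sq_vector_axiom : Vector.axiom #|{set E}| B.
Proof.
exists sq_coord.
  move=> a u v; have [p ->] := sq_pi_surj u; have [q ->] := sq_pi_surj v.
  apply/rowP=> i; rewrite -linearP.
  transitivity ((a *: p + q)@_(sq_mnm (enum_val i))); first exact: sq_coord_pi.
  have mxDZ (r s : 'rV[K]_#|{set E}|) : (a *: r + s) 0 i = a * r 0 i + s 0 i.
    by rewrite !mxE.
  by rewrite mxDZ !sq_coord_pi mcoeffD mcoeffZ.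
exists (fun r : 'rV[K]_#|{set E}| => pi (\sum_i r 0 i *: 'X_[sq_mnm (enum_val i)])) => [u|r].
  have [p ->] := sq_pi_surj u; apply/eqP; rewrite -subr_eq0 -rmorphB sq_pi_eq0.
  apply: sq_ideal_msupp => A; rewrite mcoeffB raddf_sum (bigD1 (enum_rank A)) //=.
  rewrite big1 => [|i ne_iA]; last first.
    rewrite mcoeffZ mcoeffX (inj_eq sq_mnm_inj) -(inj_eq enum_rank_inj) enum_valK.
    by rewrite (negPf ne_iA) mulr0.
  by rewrite mcoeffZ mcoeffX sq_coord_pi !enum_rankK eqxx mulr1 addr0 subrr.
apply/rowP=> i; rewrite sq_coord_pi raddf_sum (bigD1 i) //= big1 => [|j ne_ji].
  by rewrite mcoeffZ mcoeffX eqxx mulr1 addr0.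
by rewrite mcoeffZ mcoeffX (inj_eq sq_mnm_inj) (inj_eq enum_val_inj)
           (negPf ne_ji) mulr0.
Qed.

HB.instance Definition _ := Lmodule_hasFinDim.Build K B sq_vector_axiom.
HB.instance Definition _ := Algebra_isFalgebra.Build K B.

Definition xvar (e : E) : B := sq_pi (mvar K e).

(* Products of k variables span the polynomials of degree k, hence their
   classes span the degree k component of the graded algebra B(E). *)
Definition sq_alg_deg (k : nat) : {vspace B} := (<<[seq xvar e | e : E]>> ^+ k)%VS.

End SquareAlgebra.

(* Undirected multigraph with vertex set V and edge set E: an edge is mapped to
   its set of endpoints, which is a singleton exactly for loops. *)
Record mgraph (V E : finType) := MGraph {
  ends :> E -> {set V};
  ends_card : forall e, (0 < #|ends e| <= 2)%N
}.

Section VertexAlgebra.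
Variables (K : fieldType) (V E : finType) (G : mgraph V E).

Definition yvar (v : V) : sq_alg K E := \sum_(e : E) (v \in G e)%:R *: xvar K e.

Definition cplus : {vspace sq_alg K E} := <<1 & [seq yvar v | v : V]>>%VS.

Definition cplus_deg (k : nat) : {vspace sq_alg K E} :=
  (cplus :&: sq_alg_deg K E k)%VS.

End VertexAlgebra.

Section Pseudoforests.
Variables (V E : finType) (G : mgraph V E).
Implicit Types (F S C P Z : {set E}) (W : {set V}) (x y v : V).

(* A walk starting at x is given by its successive steps (e, y), where e is the
   edge taken and y the vertex reached. *)
Fixpoint walk x (s : seq (E * V)) : bool :=
  if s is (e, y) :: s' then (G e == [set x; y]) && walk y s' else true.

Definition walk_end x (s : seq (E * V)) : V := last x (unzip2 s).

Definition walk_edges (s : seq (E * V)) : {set E} := [set e in unzip1 s].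

Definition is_path P x y : Prop :=
  exists s, [/\ walk x s, walk_end x s = y, uniq (x :: unzip2 s)
              & P = walk_edges s].

Definition is_cycle C : Prop :=
  exists x s, [/\ s != [::], walk x s, walk_end x s = x,
                  uniq (unzip1 s) && uniq (unzip2 s) & C = walk_edges s].

Definition verts S : {set V} := \bigcup_(e in S) G e.

Definition adj S : rel V := [rel x y | [exists e in S, G e == [set x; y]]].

(* Below, W and S are the vertex set and the edge set of a subgraph. *)
Definition connected_graph W S : Prop :=
  W != set0 /\ {in W &, forall x y, connect (adj S) x y}.

Definition cycle_in C S : Prop := is_cycle C /\ C \subset S.

Definition is_tree W S : Prop :=
  connected_graph W S /\ forall C, ~ cycle_in C S.

Definition is_unicycle W S : Prop :=
  connected_graph W S /\ exists! C, cycle_in C S.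

Definition is_odd_unicycle W S : Prop :=
  is_unicycle W S /\ forall C, cycle_in C S -> odd #|C|.

(* The connected component of x in the spanning subgraph (V, F). *)
Definition comp_verts F x : {set V} := [set y | connect (adj F) x y].
Definition comp_edges F x : {set E} := [set e in F | G e \subset comp_verts F x].

Definition odd_pseudoforest F : Prop :=
  forall x, is_tree (comp_verts F x) (comp_edges F x)
         \/ is_odd_unicycle (comp_verts F x) (comp_edges F x).

Definition odd_pseudoforests : {set {set E}} :=
  [set F | `[< odd_pseudoforest F >]].

Definition odd_cycle C : Prop := is_cycle C /\ odd #|C|.

Definition two_odd_cycles_vertex Z : Prop :=
  exists C1 C2, [/\ odd_cycle C1, odd_cycle C2, [disjoint C1 & C2],
                    #|verts C1 :&: verts C2| = 1%N & Z = C1 :|: C2].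

Definition two_odd_cycles_bridge Z : Prop :=
  exists C1 C2 P x y,
    [/\ odd_cycle C1 /\ odd_cycle C2, [disjoint verts C1 & verts C2],
        is_path P x y /\ (0 < #|P|)%N,
        verts P :&: verts C1 = [set x] /\ verts P :&: verts C2 = [set y]
      & Z = C1 :|: P :|: C2].

Definition even_circuit Z : Prop :=
  [\/ is_cycle Z /\ ~~ odd #|Z|, two_odd_cycles_vertex Z
    | two_odd_cycles_bridge Z].

End Pseudoforests.

Section EvenActivity.
Variables (V : finType) (d : Order.disp_t) (E : finOrderType d).
Variable G : mgraph V E.
Implicit Types (F Z : {set E}) (e : E).

Definition evenly_active F e : Prop :=
  e \notin F /\
  exists Z, [/\ even_circuit G Z, Z \subset e |: F, e \in Z
              & forall f, f \in Z -> (e <= f)%O].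

Definition even_activity F : nat := #|[set e | `[< evenly_active F e >]]|.

End EvenActivity.

(* Main.v *)
From HB Require Import structures.
Require Import Defs.
From mathcomp Require Import all_boot all_order all_algebra all_field.
From mathcomp Require Import mpoly.
From mathcomp.classical Require Import boolp.

Set Implicit Arguments.
Unset Strict Implicit.
Unset Printing Implicit Defensive.

Import Order.TTheory GRing.Theory.

Local Open Scope ring_scope.

(** Give each edge e the vector a_e in K^V which is the indicator of its set of
    endpoints. Both assertions hold for the subalgebra C generated by the forms
    y_v = sum_e a_(e,v) x_e of any vector configuration, with linearly
    independent sets in place of odd-circle pseudoforests and the external
    activity of the linear matroid in place of the even activity; the graph
    only enters through the identification of this matroid.

    Vector configurations. Call passive set of an independent F the set P(F) of
    the elements outside F which are not externally active for F. The
    coefficients of the squarefree monomials x_(P(F)) are coordinates on C, and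
    on its component of degree k when restricted to the F with |P(F)| = k.
    - They separate C. If a_f is a combination of the a_t with t outside a set S
      containing f, then the coefficient of x_S in any element of C is the same
      combination of the coefficients obtained by replacing f by t in S: the
      elements with this property contain 1 and are stable under multiplication
      by the y_v (exchange_relation). A set S which is not a passive set admits
      such an f with all t larger than f, so that descent reduces every
      coefficient to those of passive sets (passive_coords_inj).
    - They satisfy no linear relation on C. The coefficient of x_S in the k-th
      power of y_l = sum_v l_v y_v, for |S| = k, is k! times the product of the
      values l(a_e), e in S (sqcoord_linformX). As k! is invertible, it remains
      to see that the products of l(a_e) over e in P(F), F independent, are
      linearly independent functions of l. This is deletion-contraction along
      the largest element e: for independent F not containing e, the factor
      l(a_e) occurs and disappears by restriction to its kernel, which isolates
      the F containing e; the other F follow by cancelling l(a_e)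
      (passive_products_free_rec).

    Graphs. A vertex labeling l annihilates the vector of an edge {x, y} exactly
    when l x + l y = 0, because 2 is invertible. So along a walk in a set of
    annihilated edges the label changes sign at each step, and it vanishes on an
    odd cycle. This gives at once that even circuits are dependent
    (even_circuit_dependent). Conversely, let D be the support of a linear
    relation. Then no vertex lies on exactly one edge of D, so that both ends
    of a longest path in D have an additional edge, which returns to the path;
    two distinct such edges always produce an even circuit
    (two_returns_even_circuit, relation_even_circuit). Hence independent sets
    are the sets without even circuits. They are the odd-circle pseudoforests:
    an odd cycle forces the labels to vanish on its whole component, and thus
    an edge outside it on another cycle would be dependent on the rest
    (independent_cycle_sub), while every even circuit that is not an even cycle
    contains two cycles in one component. Finally, in an independent set with
    one more edge e any even circuit carries a relation, which must involve e;
    this turns even activity into external activity (evenly_activeP). *)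

(** * Coordinates on the square-zero algebra *)

Section Coordinates.
Variables (K : fieldType) (E : finType).
Local Notation B := (sq_alg K E).
Implicit Types (S T : {set E}) (e f : E) (u : B).

Definition sqcoord S u : K := sq_coord u 0 (enum_rank S).

Lemma sqcoord_pi S p : sqcoord S (sq_pi p) = p@_(sq_mnm S).
Proof. by rewrite /sqcoord sq_coord_pi enum_rankK. Qed.

Lemma sqcoord_is_linear S : linear_for *%R (sqcoord S).
Proof.
move=> a u v; have [p ->] := sq_pi_surj u; have [q ->] := sq_pi_surj v.
have -> : a *: sq_pi p + sq_pi q = sq_pi (a *: p + q) :> B.
  by rewrite raddfD /= [sq_pi (a *: p)]linearZ.
by rewrite !sqcoord_pi mcoeffD mcoeffZ.
Qed.

HB.instance Definition _ S :=
  GRing.isLinear.Build K B K *%R (sqcoord S) (sqcoord_is_linear S).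

Lemma sqcoord_eq0 u : (forall S, sqcoord S u = 0) -> u = 0.
Proof.
have [p ->] := sq_pi_surj u => p0; apply/eqP; rewrite sq_pi_eq0.
by apply: sq_ideal_msupp => S; rewrite -sqcoord_pi p0.
Qed.

Lemma sqcoord1 S : sqcoord S 1 = (S == set0)%:R.
Proof.
rewrite -[1](rmorph1 (@sq_pi K E)) sqcoord_pi mcoeff1; congr (_ %:R).
have <- : sq_mnm set0 = 0%MM :> 'X_{1..#|E|}.
  by apply/mnmP=> i; rewrite mnmE mnm0E inE.
by rewrite (inj_eq (@sq_mnm_inj E)).
Qed.

Lemma sqcoord_xvarM S e u :
  sqcoord S (xvar K e * u) = (e \in S)%:R * sqcoord (S :\ e) u.
Proof.
have [p ->] := sq_pi_surj u; rewrite -rmorphM !sqcoord_pi mulrC /mvar.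
have [eS|eS] := boolP (e \in S).
  have -> : sq_mnm S = (U_(enum_rank e) + sq_mnm (S :\ e))%MM.
    apply/mnmP=> i; rewrite mnmDE !mnmE !inE.
    by have [<-|/negPf ne] := eqVneq (enum_rank e) i;
      rewrite ?enum_rankK ?eqxx ?eS // (can2_eq enum_valK enum_rankK) eq_sym ne.
  by rewrite mcoeffMX mul1r.
rewrite mul0r mcoeffM big1 // => k /eqP Dm.
rewrite mcoeffX; case: eqP => [Dk|]; last by rewrite mulr0.
have /mnmP/(_ (enum_rank e)) := Dm; rewrite mnmDE -Dk mnm1E eqxx.
by rewrite mnmE enum_rankK (negPf eS) addn1.
Qed.

Lemma sqcoord_deg k S u : u \in sq_alg_deg K E k -> #|S| != k -> sqcoord S u = 0.
Proof.
pose Z j := (\bigcap_(T : {set E} | #|T| != j) lker (linfun (sqcoord T : B -> K^o)))%VS.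
have memZ j v : reflect (forall T, #|T| != j -> sqcoord T v = 0) (v \in Z j).
  rewrite memvE; apply: (iffP subv_bigcapP) => H T hT.
    by have := H T hT; rewrite -memvE memv_ker lfunE /= => /eqP.
  by rewrite -memvE memv_ker lfunE /= H.
suff sZ : (sq_alg_deg K E k <= Z k)%VS by move=> /(subvP sZ)/memZ; apply.
elim: k => [|k IH]; rewrite /sq_alg_deg.
  rewrite expv0 -memvE; apply/memZ => T; rewrite cards_eq0 sqcoord1.
  by move/negPf->.
rewrite expvSl; apply/prodvP => x v /coord_span-> /(subvP IH)/memZ v0.
rewrite mulr_suml rpred_sum // => i _; rewrite -scalerAl rpredZ //.
have /mapP[e _ ->] : [seq xvar K e | e : E]`_i \in [seq xvar K e | e : E].
  by rewrite mem_nth // size_map -cardE.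
apply/memZ=> T; rewrite sqcoord_xvarM.
case: (boolP (e \in T)) => eT; last by rewrite mul0r.
by rewrite (cardsD1 e T) eT eqSS => /v0->; rewrite mulr0.
Qed.

End Coordinates.

(** * Linear dependence in a vector configuration *)

Section VectorConfiguration.
Variables (K : fieldType) (V E : finType) (a : E -> V -> K).
Implicit Types (l : V -> K) (Q F T S : {set E}) (e f : E).

Definition value l e : K := \sum_v l v * a e v.

Definition kills l Q := forall q, q \in Q -> value l q = 0.

(** Membership of a_e in the span of the a_q, q in Q, in the form of the double
    annihilator: for graphs, linear functions are vertex labelings, which are
    easier to follow along walks than coefficients. *)
Definition spanned Q e : bool :=
  `[< forall l, kills l Q -> value l e = 0 >].

Lemma spannedP Q e :
  reflect (forall l, kills l Q -> value l e = 0) (spanned Q e).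
Proof. exact: asboolP. Qed.

Lemma spannedPn Q e :
  reflect (exists2 l, kills l Q & value l e != 0) (~~ spanned Q e).
Proof.
apply: (iffP idP) => [|[l lQ]]; last by apply: contraNN => /spannedP->.
move/asboolPn/existsNP=> [l /not_implyP[lQ /eqP le]]; by exists l.
Qed.

Lemma killsS l Q F : Q \subset F -> kills l F -> kills l Q.
Proof. by move=> sQF lF q /(subsetP sQF)/lF. Qed.

Lemma spannedS Q F e : Q \subset F -> spanned Q e -> spanned F e.
Proof. by move=> sQF /spannedP Qe; apply/spannedP => l /(killsS sQF)/Qe. Qed.

Lemma valueD l l' e s :
  value (fun v => l v + s * l' v) e = value l e + s * value l' e.
Proof.
rewrite /value mulr_sumr -big_split; apply: eq_bigr => v _ /=.
by rewrite mulrDl mulrA.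
Qed.

(** A vector outside the row space of a matrix M is detected by some column of
    the cokernel of M; such a column is a linear function killing Q. *)
Lemma spanned_coef Q e :
  reflect (exists c : E -> K, forall v, a e v = \sum_(q in Q) c q * a q v)
          (spanned Q e).
Proof.
apply: (iffP idP) => [Qe|[c Dc]]; last first.
  apply/spannedP => l lQ; rewrite /value.
  transitivity (\sum_(q in Q) c q * value l q).
    under eq_bigr => v _ do rewrite Dc mulr_sumr.
    rewrite exchange_big; apply: eq_bigr => q _ /=.
    by rewrite mulr_sumr; apply: eq_bigr => v _; rewrite mulrCA.
  by rewrite big1 // => q /lQ->; rewrite mulr0.
pose u : 'rV[K]_#|V| := \row_j a e (enum_val j).
pose M : 'M[K]_(#|E|, #|V|) :=
  \matrix_(i, j) ((enum_val i \in Q)%:R * a (enum_val i) (enum_val j)).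
have valE (w : 'cV[K]_#|V|) b :
  \sum_j a b (enum_val j) * w j 0 = value (fun v => w (enum_rank v) 0) b.
  rewrite /value (reindex (@enum_val V V)) /=; last first.
    by apply: onW_bij; apply: enum_val_bij.
  by apply: eq_bigr => j _; rewrite enum_valK mulrC.
have /submxP[D /rowP eqD] : (u <= M)%MS.
  rewrite submxE; apply/eqP/rowP => k; rewrite [RHS]mxE.
  pose w := col k (cokermx M).
  have wQ : kills (fun v => w (enum_rank v) 0) Q.
    move=> q qQ; rewrite -valE.
    have /colP/(_ (enum_rank q)) : M *m w = 0.
      by rewrite /w colE mulmxA mulmx_coker mul0mx.
    by rewrite !mxE; under eq_bigr => j _ do rewrite mxE enum_rankK qQ mul1r.
  move/spannedP/(_ _ wQ): Qe; rewrite -valE => <-.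
  by rewrite mxE; apply: eq_bigr => j _; rewrite !mxE.
exists (fun q => D 0 (enum_rank q)) => v.
have := eqD (enum_rank v); rewrite !mxE enum_rankK => ->.
rewrite [RHS]big_mkcond /= [RHS](reindex (@enum_val E E)) /=; last first.
  by apply: onW_bij; apply: enum_val_bij.
apply: eq_bigr => i _; rewrite !mxE enum_valK enum_rankK.
by case: ifP; rewrite ?mul1r // mul0r mulr0.
Qed.

Lemma dependent_relation Q e : e \in Q -> spanned (Q :\ e) e ->
  exists w : E -> K, w e != 0 /\ forall v, \sum_(q in Q) w q * a q v = 0.
Proof.
move=> eQ /spanned_coef[c Dc].
exists (fun q => if q == e then -1 else c q); rewrite eqxx oppr_eq0 oner_eq0.
split=> // v; rewrite (big_setD1 e) //= eqxx Dc mulN1r addrC.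
apply/eqP; rewrite subr_eq0; apply/eqP/eq_bigr => q.
by rewrite !inE => /andP[/negPf->].
Qed.

Lemma relation_value (w : E -> K) Q l :
  (forall v, \sum_(q in Q) w q * a q v = 0) ->
  \sum_(q in Q) w q * value l q = 0.
Proof.
move=> w0; under eq_bigr => q _ do rewrite mulr_sumr.
rewrite exchange_big big1 // => v _ /=.
transitivity (l v * \sum_(q in Q) w q * a q v); last by rewrite w0 mulr0.
by rewrite mulr_sumr; apply: eq_bigr => q _; rewrite mulrCA.
Qed.

(** Evaluating the relation at a function that kills the rest of its support
    leaves the single term of e. *)
Lemma relation_spanned (w : E -> K) Q e :
  (forall v, \sum_(q in Q) w q * a q v = 0) -> e \in Q -> w e != 0 ->
  spanned [set q in Q :\ e | w q != 0] e.
Proof.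
move=> w0 eQ we; apply/spannedP => l lQ.
have := relation_value l w0; rewrite (big_setD1 e) //= big1 ?addr0 => [|q qQ].
  by move/eqP; rewrite mulf_eq0 (negPf we) => /eqP.
have [->|wq] := eqVneq (w q) 0; first by rewrite mul0r.
by rewrite lQ ?mulr0 // inE qQ.
Qed.

End VectorConfiguration.

(** * Dimension and activity for a vector configuration *)

Section DimensionByCoordinates.
Variables (K : fieldType) (B : vectType K) (I : finType).

(** The matrix of the coordinates on a basis of W has independent rows by the
    first hypothesis and independent columns by the second one. *)
Lemma dim_eq_card_coords (W : {vspace B}) (J : {set I}) (phi : I -> {scalar B}) :
  {in W, forall u, {in J, forall i, phi i u = 0} -> u = 0} ->
  (forall c : I -> K, {in W, forall u, \sum_(i in J) c i * phi i u = 0} ->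
     {in J, forall i, c i = 0}) ->
  \dim W = #|J|.
Proof.
move=> inj free; set b := vbasis W.
pose M : 'M[K]_(\dim W, #|J|) := \matrix_(i, j) phi (enum_val j) b`_i.
have bW i : b`_i \in W.
  have [lt|ge] := ltnP i (\dim W); last by rewrite nth_default ?mem0v // size_tuple.
  by rewrite vbasis_mem // mem_nth // size_tuple.
have rM : row_free M.
  apply: inj_row_free => r /rowP rM0.
  have ub0 : \sum_i r 0 i *: b`_i = 0.
    apply: inj => [|i iJ]; first by apply: rpred_sum => i _; rewrite rpredZ.
    rewrite linear_sum /=; have := rM0 (enum_rank_in iJ i).
    rewrite !mxE => M0; rewrite -[RHS]M0; apply: eq_bigr => j _.
    by rewrite linearZ /= mxE enum_rankK_in.
  have /freeP fb := basis_free (vbasisP W).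
  by apply/rowP=> i; rewrite mxE (fb (fun i => r 0 i) ub0).
have rMt : row_free M^T.
  apply: inj_row_free => r /rowP rM0.
  pose c i := if [pick j : 'I_#|J| | enum_val j == i] is Some j then r 0 j else 0.
  have Dc j : c (enum_val j) = r 0 j.
    rewrite /c; case: pickP => [k /eqP/enum_val_inj->//|/(_ j)].
    by rewrite eqxx.
  suff c0 : {in J, forall i, c i = 0}.
    by apply/rowP=> j; rewrite mxE -Dc c0 ?enum_valP.
  apply: free => u /coord_vbasis->; rewrite -/b.
  have sum0 (x : 'I_(\dim W)) : \sum_(i in J) c i * phi i b`_x = 0.
    rewrite big_enum_val; have := rM0 x; rewrite !mxE => M0; rewrite -[RHS]M0.
    by apply: eq_bigr => j _; rewrite Dc !mxE.
  under eq_bigr => i _ do rewrite linear_sum mulr_sumr.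
  rewrite exchange_big big1 //= => x _.
  under eq_bigr => i _ do rewrite linearZ /= mulrCA.
  by rewrite -mulr_sumr sum0 mulr0.
by move: rM rMt; rewrite /row_free mxrank_tr => /eqP-> /eqP.
Qed.
End DimensionByCoordinates.

Section ActivityTheorem.
Variables (K : fieldType) (charK0 : [pchar K] =i pred0) (V : finType).
Variables (d : Order.disp_t) (E : finOrderType d) (a : E -> V -> K).
Local Notation B := (sq_alg K E).
Implicit Types (l : V -> K) (Q F T S I : {set E}) (e f : E).

Definition above e F : {set E} := [set f in F | (e < f)%O].

(** The least element of the support of a linear relation is spanned by the
    larger ones, so this is linear independence of the family F. In this form
    it restricts to the part of F above any element, which is what inductions
    along the order of E require. *)
Definition indep F : bool := [forall e in F, ~~ spanned a (above e F) e].

Definition active F : {set E} :=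
  [set e | (e \notin F) && spanned a (above e F) e].

Definition passive F : {set E} := ~: (F :|: active F).

Lemma natr_inj_char0 (m n : nat) : m%:R = n%:R :> K -> m = n.
Proof.
have /pcharf0P K0 := charK0; wlog le_mn : m n / (m <= n)%N.
  by move=> W; case/orP: (leq_total m n) => le /= E0; [|apply/esym]; apply: W.
move/esym/eqP; rewrite -subr_eq0 -natrB // K0 subn_eq0 => le_nm.
by apply/eqP; rewrite eqn_leq le_mn.
Qed.

Lemma poly_vanishing (p : {poly K}) : (forall s, p.[s] = 0) -> p = 0.
Proof.
move=> p0; apply/eqP; apply/idPn => nz_p.
have := max_poly_roots nz_p (rs := [seq i%:R | i <- iota 0 (size p)]).
rewrite map_inj_uniq ?iota_uniq => [|m n]; last exact: natr_inj_char0.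
rewrite size_map size_iota ltnn => H; suff : false by []; apply: H => //.
by apply/allP => x _; rewrite /root p0.
Qed.

(** On a line in the direction of a function l0 with value l0 e <> 0, both
    factors are polynomials in one parameter, and the first one is nonzero. *)
Lemma value_cancel Q e (J : pred {set E}) (c : {set E} -> K)
    (X : {set E} -> {set E}) :
  let f l := \sum_(I | J I) c I * \prod_(q in X I) value a l q in
  ~~ spanned a Q e -> (forall l, kills a l Q -> value a l e * f l = 0) ->
  forall l, kills a l Q -> f l = 0.
Proof.
move=> f /spannedPn[l0 l0Q l0e] ef0 l lQ.
pose lin q := (value a l q)%:P + value a l0 q *: 'X.
pose p := \sum_(I | J I) c I *: \prod_(q in X I) lin q.
have linE q s : (lin q).[s] = value a (fun v => l v + s * l0 v) q.
  by rewrite valueD !hornerE mulrC.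
have pE s : p.[s] = f (fun v => l v + s * l0 v).
  rewrite horner_sum; apply: eq_bigr => I _; rewrite hornerZ horner_prod.
  by congr (_ * _); apply: eq_bigr => q _; rewrite linE.
have /eqP : lin e * p = 0.
  apply: poly_vanishing => s; rewrite hornerM linE pE ef0 // => q qQ.
  by rewrite valueD lQ // l0Q // mulr0 addr0.
rewrite mulf_eq0 => /orP[/eqP le0|/eqP p0].
  have := congr1 (fun p : {poly K} => p`_1) le0.
  by rewrite !coefE /= mulr1 add0r => /eqP; rewrite (negPf l0e).
have := pE 0; rewrite p0 horner0 => ->; rewrite /f.
congr bigop; apply/funext => I; congr BigBody; congr (_ * _).
by apply: eq_bigr => q _; rewrite valueD mul0r addr0.
Qed.

Lemma exists_greatest T :
  T != set0 -> exists2 e, e \in T & forall f, f \in T -> (f <= e)%O.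
Proof.
case/set0Pn=> e0 e0T.
by case: (@Order.TotalTheory.arg_maxP _ _ E e0 (mem T) id e0T) => e eT le_e; exists e.
Qed.

(** The elements of T remain to be treated. Among those outside T, the
    independent sets under consideration contain exactly Q (these elements
    have been contracted, which amounts to restricting functions to those
    killing Q), and the others have been deleted. The greatest element e of T
    is handled next: since above e I is then Q, whether e is active for I does
    not depend on I. If e is spanned by Q, it belongs to no I and to no
    passive set. Otherwise e is in the passive set of I exactly when it is not
    in I, and restriction to the functions vanishing at e separates the two
    cases. *)
Lemma passive_products_free_rec T Q (c : {set E} -> K) :
  (forall e f, e \in T -> (f < e)%O -> f \in T) ->
  (forall l, kills a l Q ->
     \sum_(I | indep I && (I :\: T == Q))
        c I * \prod_(e in passive I :&: T) value a l e = 0) ->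
  forall I, indep I -> I :\: T = Q -> c I = 0.
Proof.
have [n] := ubnP #|T|; elim: n => // n IH in T Q * => le_Tn downT sum0 I0 indI0 I0Q.
have [T0|] := eqVneq T set0.
  subst T; rewrite setD0 in I0Q; subst Q.
  have := sum0 (fun=> 0) _; rewrite (big_pred1 I0) => [|I]; last first.
    by rewrite setD0 /=; case: eqP => [->|_]; rewrite ?indI0 ?andbF.
  rewrite setI0 big_set0 mulr1; apply=> q _.
  by rewrite /value big1 // => v _; rewrite mul0r.
case/exists_greatest=> e eT max_e.
pose T' := T :\ e.
have le_T'n : (#|T'| < n)%N by move: le_Tn; rewrite (cardsD1 e) eT.
have downT' g f : g \in T' -> (f < g)%O -> f \in T'.
  rewrite !inE => /andP[_ gT] fg; rewrite (downT g f) // andbT.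
  by apply: contraTneq fg => ->; rewrite -leNgt max_e.
have eQ : e \notin Q by rewrite -I0Q inE eT.
have aboveE I : above e I = I :\: T.
  apply/setP=> f; rewrite !inE andbC; congr (_ && _).
  have [fT|] := boolP (f \in T); first by rewrite ltNge max_e.
  apply: contraNT; rewrite -leNgt le_eqVlt => /orP[/eqP->//|].
  exact: downT.
have T'E I : e \in I -> I :\: T' = e |: (I :\: T).
  move=> eI; apply/setP=> f; rewrite !inE negb_and negbK.
  by case: (eqVneq f e) => [->|_] //=; rewrite eI.
have T'E' I : e \notin I -> I :\: T' = I :\: T.
  move=> eI; apply/setP=> f; rewrite !inE negb_and negbK.
  by case: (eqVneq f e) => [->|_] //=; rewrite (negPf eI) andbF.
have TT' I : e \notin passive I -> passive I :&: T = passive I :&: T'.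
  move=> eI; apply/setP=> f; rewrite !inE.
  by case: (eqVneq f e) => [->|_] //=; move: eI; rewrite !inE => /negPf->.
have predE I : indep I && (I :\: T' == Q) = (indep I && (I :\: T == Q)) && (e \notin I).
  have [eI|eI] /= := boolP (e \in I); last by rewrite T'E' // andbT.
  rewrite andbF; apply/negP=> /andP[_ /eqP IQ].
  by move: eQ; rewrite -IQ !inE eqxx eI.
have [Qe|Qe] := boolP (spanned a Q e).
  have eI I : indep I -> I :\: T = Q -> e \notin I.
    move=> /forall_inP indI IQ; apply/negP=> /indI.
    by rewrite aboveE IQ Qe.
  apply: (IH T' Q) => // [l lQ|]; last by rewrite T'E' ?eI.
  apply: etrans (sum0 l lQ); apply: eq_big => I.
    by rewrite predE; apply/andb_idr => /andP[iI /eqP IQ]; apply: eI.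
  rewrite predE => /andP[/andP[indI /eqP IQ] eI']; rewrite TT' //.
  by rewrite !inE negbK aboveE IQ Qe eI' orbT.
have nact I : I :\: T = Q -> e \in I = (e \notin passive I).
  by move=> IQ; rewrite !inE aboveE IQ (negPf Qe) andbF orbF negbK.
have split_sum l : kills a l Q ->
  \sum_(I | indep I && (I :\: T' == e |: Q))
        c I * \prod_(e in passive I :&: T') value a l e +
  value a l e * \sum_(I | indep I && (I :\: T' == Q))
        c I * \prod_(e in passive I :&: T') value a l e = 0.
  move=> lQ; apply: etrans (sum0 l lQ).
  rewrite [RHS](bigID (fun I => e \in I)) /=; congr (_ + _).
    apply: eq_big => I.
      rewrite -andbA; congr (_ && _); apply/eqP/andP => [IQ|[/eqP IQ eI]].
        have eI : e \in I by move/setP/(_ e): IQ; rewrite !inE !eqxx /=.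
        split=> //; apply/eqP; move: IQ; rewrite T'E // => /(congr1 (fun A : {set E} => A :\ e)).
        by rewrite !setU1K // !inE eT.
      by rewrite T'E // IQ.
    case/andP=> indI /eqP IQ.
    have eI : e \in I by move/setP/(_ e): IQ; rewrite !inE !eqxx /=.
    by rewrite TT' // !inE eI.
  rewrite mulr_sumr; apply: eq_big => I; first exact: predE.
  rewrite predE => /andP[/andP[indI /eqP IQ] eI].
  rewrite mulrCA [in RHS](big_setD1 e) /=; last by rewrite in_setI eT andbT -[_ \in _]negbK -nact.
  by rewrite setIDA.
have cI I : indep I -> I :\: T = Q -> e \in I -> c I = 0.
  move=> indI IQ eI; apply: (IH T' (e |: Q)) => // [l lQ|]; last by rewrite T'E // IQ.
  have := split_sum l (killsS (subsetUr _ _) lQ).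
  by rewrite lQ ?setU11 // mul0r addr0.
have [eI|eI] := boolP (e \in I0); first exact: cI.
apply: (IH T' Q) => //; last by rewrite T'E'.
apply: (value_cancel Qe) => l lQ; have := split_sum l lQ.
rewrite big1 ?add0r // => I /andP[indI /eqP IQ].
have eI' : e \in I by move/setP/(_ e): IQ; rewrite !inE !eqxx /=.
rewrite cI ?mul0r //; apply/setP=> f; move/setP/(_ f): IQ.
by rewrite T'E // !inE; case: eqVneq => //= ->; rewrite eT (negPf eQ).
Qed.

Lemma passive_products_free (J : {set {set E}}) (c : {set E} -> K) :
  {in J, forall I, indep I} ->
  (forall l, \sum_(I in J) c I * \prod_(e in passive I) value a l e = 0) ->
  {in J, forall I, c I = 0}.
Proof.
move=> indJ sum0 I IJ.
have := @passive_products_free_rec setT set0 (fun I => if I \in J then c I else 0).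
move=> /(_ _ _ I (indJ _ IJ)); rewrite IJ setDT; apply=> // l _.
apply: etrans (sum0 l); rewrite (bigID (mem J)) /= [X in _ + X]big1 ?addr0.
  apply: eq_big => [X|X /andP[_ ->]]; last by rewrite setIT.
  by rewrite setDT eqxx andbT; apply/andb_idl/indJ.
by move=> X /andP[_ /negPf->]; rewrite mul0r.
Qed.

Definition linform (b : E -> K) : B := \sum_e b e *: xvar K e.

Definition generators : seq B := [seq linform (a^~ v) | v : V].

Local Notation C := <<1 & generators>>%VS.

Lemma sqcoord_linformM (b : E -> K) u S :
  sqcoord S (linform b * u) = \sum_(e in S) b e * sqcoord (S :\ e) u.
Proof.
rewrite mulr_suml linear_sum /= [RHS]big_mkcond; apply: eq_bigr => e _ /=.
rewrite -scalerAl linearZ /= sqcoord_xvarM.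
by case: (e \in S); rewrite ?mul1r // mul0r mulr0.
Qed.

(** Each squarefree monomial of degree k arises from k! orderings of its
    factors. *)
Lemma sqcoord_linformX (b : E -> K) k S :
  sqcoord S (linform b ^+ k) = k`!%:R * ((#|S| == k)%:R * \prod_(e in S) b e).
Proof.
elim: k S => [|k IH] S.
  rewrite expr0 sqcoord1 mul1r cards_eq0.
  by have [->|_] := eqVneq S set0; rewrite ?mul0r // big_set0 mulr1.
rewrite exprS sqcoord_linformM.
transitivity (\sum_(e in S) (k`!)%:R * ((#|S| == k.+1)%:R * \prod_(f in S) b f)).
  apply: eq_bigr => e eS; rewrite IH mulrCA; congr (_ * _).
  by rewrite mulrCA [in RHS](big_setD1 e) //= (cardsD1 e S) eS eqSS.
rewrite sumr_const; case: eqP => [->|_]; last by rewrite /= !mul0r !mulr0 mul0rn.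
by rewrite -[LHS]mulr_natl mulrA factS natrM.
Qed.

Lemma linform_value l :
  linform (value a l) = \sum_v l v *: linform (a^~ v).
Proof.
under [RHS]eq_bigr => v _ do rewrite scaler_sumr.
rewrite exchange_big; apply: eq_bigr => e _ /=.
by rewrite scaler_suml; apply: eq_bigr => v _; rewrite scalerA.
Qed.

Lemma linform_value_mem l : linform (value a l) \in C.
Proof.
rewrite linform_value rpred_sum // => v _; rewrite rpredZ //.
have : linform (a^~ v) \in generators by apply: image_f.
exact: seqv_sub_adjoin.
Qed.

Lemma linform_valueX_mem l k : linform (value a l) ^+ k \in C.
Proof.
elim: k => [|k IH]; first by rewrite expr0 memvE sub1_agenv.
by rewrite exprS -agenvM memv_mul ?linform_value_mem.
Qed.

Lemma linformX_deg (b : E -> K) k : linform b ^+ k \in sq_alg_deg K E k.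
Proof.
elim: k => [|k IH]; first by rewrite expr0 /sq_alg_deg expv0 memv_line.
rewrite exprS /sq_alg_deg expvSl memv_mul // rpred_sum // => e _.
rewrite rpredZ // memv_span //; exact: image_f.
Qed.

(** The subspace R of the elements satisfying the relation for all admissible S
    is stable under multiplication by the generators: expanding the coefficient
    of x_S in y_v * u, the term in which y_v contributes x_f matches, by the
    choice of c, the terms in which it contributes x_t, and the remaining terms
    are the relations of u for the sets S :\ e. *)
Lemma exchange_relation (f : E) T (c : E -> K) :
  (forall v, a f v = \sum_(t in T) c t * a t v) ->
  forall u S, u \in C -> f \in S -> [disjoint S & T] ->
  sqcoord S u = \sum_(t in T) c t * sqcoord (t |: (S :\ f)) u.
Proof.
move=> Df.
pose P (S : {set E}) := (f \in S) && [disjoint S & T].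
pose lin S : 'Hom(B, K^o) := linfun (sqcoord S : B -> K^o).
pose R := (\bigcap_(S | P S)
  lker (lin S - \sum_(t in T) c t *: lin (t |: (S :\ f))))%VS.
have memR u : reflect (forall S, P S ->
    sqcoord S u = \sum_(t in T) c t * sqcoord (t |: (S :\ f)) u) (u \in R).
  have E0 S : (u \in lker (lin S - \sum_(t in T) c t *: lin (t |: (S :\ f)))) =
    (sqcoord S u == \sum_(t in T) c t * sqcoord (t |: (S :\ f)) u).
    rewrite memv_ker add_lfunE opp_lfunE sum_lfunE subr_eq0 lfunE /=.
    by congr (_ == _); apply: eq_bigr => t _; rewrite scale_lfunE lfunE.
  rewrite memvE; apply: (iffP subv_bigcapP) => H S PS.
    by have := H S PS; rewrite -memvE E0 => /eqP.
  by rewrite -memvE E0 H.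
suff sCR : (C <= R)%VS by move=> u S /(subvP sCR)/memR H fS dST; apply/H/andP.
have R1 : (1 <= R)%VS.
  rewrite -memvE; apply/memR => S /andP[fS _]; rewrite sqcoord1 big1.
    by case: eqP => // S0; rewrite S0 inE in fS.
  move=> t _; rewrite sqcoord1; case: eqP => [/setP/(_ t)|]; rewrite ?mulr0 //.
  by rewrite !inE eqxx.
apply: agenv_sub_modl => //; rewrite prodvDl prod1v subv_add subvv.
apply/prodvP => x u /coord_span-> /memR uR.
rewrite mulr_suml rpred_sum // => i _; rewrite -scalerAl rpredZ //.
have /mapP[v _ ->] : generators`_i \in generators.
  by rewrite mem_nth // size_map -cardE.
apply/memR => S /andP[fS dST]; rewrite sqcoord_linformM (big_setD1 f) //=.
have tS t : t \in T -> t \notin S by move=> tT; rewrite (disjointFl dST).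
have tf t : t \in T -> t != f by move=> /tS; apply: contraNneq => ->.
transitivity (\sum_(t in T) c t * (a t v * sqcoord (S :\ f) u) +
   \sum_(t in T) \sum_(e in S :\ f) c t * (a e v * sqcoord ((t |: (S :\ f)) :\ e) u)).
  congr (_ + _).
    by rewrite Df mulr_suml; apply: eq_bigr => t _; rewrite mulrA.
  rewrite exchange_big; apply: eq_bigr => e /setD1P[ef eS] /=.
  rewrite uR; last first.
    rewrite /P !inE eq_sym ef fS /=.
    by apply: disjointWl dST; apply: subsetDl.
  rewrite mulr_sumr; apply: eq_bigr => t tT; rewrite mulrCA.
  do 2!congr (_ * _); congr (sqcoord _ _); apply/setP => g; rewrite !inE.
  have [->|_] := eqVneq g t; last by rewrite andbCA.
  by rewrite /= ?andbT; apply/esym; apply: contraNneq (tS t tT) => ->.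
rewrite -big_split; apply: eq_bigr => t tT /=.
rewrite sqcoord_linformM big_setU1 /=; last by rewrite !inE negb_and tS ?orbT.
rewrite setU1K; last by rewrite !inE negb_and tS ?orbT.
by rewrite mulrDr mulr_sumr.
Qed.

(** Let I be the greedy basis, from the top, of the complement of S. Elements of
    the complement outside I are active for I. So if S is not the passive set
    of I, some f active for I lies in S, and the relation that spans f by the
    larger elements of I trades f for larger elements. *)
Lemma passive_coords_inj u :
  u \in C -> {in indep, forall I, sqcoord (passive I) u = 0} -> u = 0.
Proof.
move=> uC u0; apply: sqcoord_eq0 => S.
(* This weight of S decreases when an element of S is replaced by a larger one. *)
pose m S := (\sum_(e in S) #|[set f | (e < f)%O]|)%N.
have [n] := ubnP (m S); elim: n => // n IH in S * => lt_m.
pose T := ~: S; pose I := [set t in T | ~~ spanned a (above t T) t].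
have sIT : I \subset T by apply/subsetP => t; rewrite inE => /andP[].
have aboveS e F F' : F \subset F' -> above e F \subset above e F'.
  move=> /subsetP sF; apply/subsetP=> f; rewrite !inE => /andP[/sF-> ->] //.
have indI : indep I.
  apply/forall_inP => e; rewrite inE => /andP[_]; apply: contraNN.
  by apply: spannedS; apply: aboveS.
have killsT l e : kills a l (above e I) -> kills a l (above e T).
  move=> lI t; have [j] := ubnP #|above t T|; elim: j t => // j IHj t lt_j.
  rewrite inE => /andP[tT lt_et]; have [tI|] := boolP (t \in I).
    by apply: lI; rewrite inE tI.
  rewrite inE tT negbK => /spannedP; apply=> t'; rewrite inE => /andP[t'T lt_tt'].
  apply: IHj; last by rewrite inE t'T (lt_trans lt_et).
  apply: leq_trans (proper_card _) (ltnSE lt_j); apply/properP; split.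
    by apply/subsetP=> g; rewrite !inE => /andP[-> /(lt_trans lt_tt')].
  by exists t'; rewrite inE ?t'T ?lt_tt' ?ltxx ?andbF.
have [PS|neq] := eqVneq S (passive I); first by rewrite PS u0.
have [f fact fS] : exists2 f, f \in active I & f \in S.
  have [/subsetP sAT|/subsetPn[f fA]] := boolP (active I \subset T); last first.
    by rewrite inE negbK => fS; exists f.
  case/eqP: neq; apply/setP => e; rewrite inE in_setU negb_or.
  apply/idP/andP => [eS|[eI eA]]; last first.
    apply: contraNT eA => eS; rewrite inE eI /=.
    have eT : e \in T by rewrite inE.
    move: eI; rewrite inE eT negbK => /spannedP eT'.
    by apply/spannedP => l /killsT/eT'.
  split; first by apply: contraTN eS => /(subsetP sIT); rewrite inE.
  by apply: contraTN eS => /sAT; rewrite inE.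
have /spanned_coef[c Dc] : spanned a (above f I) f by move: fact; rewrite inE => /andP[].
rewrite (exchange_relation Dc uC fS); last first.
  rewrite disjoint_sym disjoints_subset; apply: subset_trans sIT.
  by apply/subsetP => t; rewrite inE => /andP[].
rewrite big1 // => t; rewrite inE => /andP[tI lt_ft]; rewrite IH ?mulr0 //.
have tS : t \notin S by have := subsetP sIT t tI; rewrite inE.
apply: leq_trans (ltnSE lt_m).
rewrite /m big_setU1 /= ?inE ?(negPf tS) ?andbF // [X in (_ < X)%N](big_setD1 f) //=.
rewrite ltn_add2r proper_card //; apply/properP; split.
  by apply/subsetP=> g; rewrite !inE; apply: lt_trans.
by exists t; rewrite !inE ?lt_ft ?ltxx.
Qed.

(** The k-th powers of the forms y_l see exactly the coordinates of degree k. *)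
Lemma passive_coords_free (J : {set {set E}}) (c : {set E} -> K) k :
  {in J, forall I, indep I} ->
  (forall l, \sum_(I in J) c I * sqcoord (passive I) (linform (value a l) ^+ k) = 0) ->
  forall I, I \in J -> #|passive I| = k -> c I = 0.
Proof.
move=> indJ sum0 I IJ Ik.
apply: (@passive_products_free [set I in J | #|passive I| == k]).
- by move=> F; rewrite inE => /andP[/indJ].
- move=> l; have /eqP := sum0 l.
  have k_neq0 : k`!%:R != 0 :> K.
    have /pcharf0P-> := charK0; by rewrite -lt0n fact_gt0.
  under eq_bigr => F _ do rewrite sqcoord_linformX mulrCA.
  rewrite -mulr_sumr mulf_eq0 (negPf k_neq0) => /eqP sum0'.
  apply: etrans sum0'; rewrite [RHS](bigID (fun F => #|passive F| == k)) /=.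
  rewrite [X in _ + X]big1 ?addr0 => [|F /andP[_ /negPf->]]; last first.
    by rewrite mul0r mulr0.
  apply: eq_big => [F|F]; rewrite inE // => /andP[_ ->].
  by rewrite mul1r.
by rewrite inE IJ Ik eqxx.
Qed.

Theorem dim_vector_subalgebra : \dim C = #|[set F | indep F]|.
Proof.
apply: (@dim_eq_card_coords _ _ _ _ _ (fun F => sqcoord (passive F) : {scalar B})).
  move=> u uC /= u0; apply: passive_coords_inj uC _ => I indI.
  by rewrite u0 // inE.
move=> c sum0 F FJ.
apply: (passive_coords_free _ _ FJ erefl) => [I|l]; first by rewrite inE.
by apply: sum0; apply: linform_valueX_mem.
Qed.

Theorem dim_vector_subalgebra_deg k :
  \dim (C :&: sq_alg_deg K E k) = #|[set F | indep F & #|passive F| == k]|.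
Proof.
apply: (@dim_eq_card_coords _ _ _ _ _ (fun F => sqcoord (passive F) : {scalar B})).
  move=> u /memv_capP[uC uk] /= u0; apply: passive_coords_inj uC _ => I indI.
  have [eqk|neqk] := eqVneq #|passive I| k; last exact: sqcoord_deg uk neqk.
  by rewrite u0 // inE eqk eqxx andbT.
move=> c sum0 F FJ.
apply: (@passive_coords_free _ c k _ _ F FJ) => [I|l|].
- by rewrite inE => /andP[].
- by apply: sum0; rewrite memv_cap linform_valueX_mem linformX_deg.
by move: FJ; rewrite inE => /andP[_ /eqP].
Qed.

End ActivityTheorem.

(** * Walks, cycles and even circuits *)

Section Walks.
Variables (V E : finType) (G : mgraph V E).
Implicit Types (x y z v : V) (e f g q : E) (s t : seq (E * V)) (C D Z : {set E}).

Lemma edge_other v e : v \in G e -> exists z, G e = [set v; z].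
Proof.
move=> ve; have /andP[_] := ends_card G e; rewrite (cardsD1 v) ve ltnS leq_eqVlt.
case/orP=> [/cards1P[z Ge]|]; last rewrite ltnS leqn0 cards_eq0 => /eqP Ge.
  by exists z; rewrite -(setD1K ve) Ge.
by exists v; rewrite -(setD1K ve) Ge setU0 setUid.
Qed.

Lemma walk_cat x s t :
  walk G x (s ++ t) = walk G x s && walk G (walk_end x s) t.
Proof. by elim: s x => [|[e y] s IH] x //=; rewrite IH andbA. Qed.

Lemma walk_end_cat x s t : walk_end x (s ++ t) = walk_end (walk_end x s) t.
Proof. by rewrite /walk_end /unzip2 map_cat last_cat. Qed.

Lemma walk_edge_mem x s e v :
  walk G x s -> e \in unzip1 s -> v \in G e -> v \in x :: unzip2 s.
Proof.
elim: s x => [|[f y] s IH] x //= /andP[/eqP Gf ws].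
rewrite inE => /orP[/eqP->|es ve]; last by rewrite inE (IH y) ?orbT.
by rewrite Gf !inE => /orP[]->; rewrite ?orbT.
Qed.

Lemma walk_vertex_edge x s v :
  walk G x s -> v \in unzip2 s -> exists2 e, e \in unzip1 s & v \in G e.
Proof.
elim: s x => [|[f y] s IH] x //= /andP[/eqP Gf ws].
rewrite inE => /orP[/eqP->|/(IH _ ws)[e es ve]].
  by exists f; rewrite ?inE ?eqxx // Gf !inE eqxx orbT.
by exists e; rewrite // inE es orbT.
Qed.

Lemma path_uniq_edges x s :
  walk G x s -> uniq (x :: unzip2 s) -> uniq (unzip1 s).
Proof.
elim: s x => [|[f y] s IH] x //= /andP[/eqP Gf ws] /andP[xs us].
rewrite (IH y) // andbT; apply: contra xs => fs.
by apply: (walk_edge_mem ws fs); rewrite Gf !inE eqxx.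
Qed.

Lemma walk_rev x s : walk G x s ->
  exists t, [/\ walk G (walk_end x s) t, walk_end (walk_end x s) t = x,
                unzip1 t = rev (unzip1 s)
              & walk_end x s :: unzip2 t = rev (x :: unzip2 s)].
Proof.
elim: s x => [|[f y] s IH] x /=; first by exists [::].
case/andP=> /eqP Gf /IH[t [wt et t1 t2]]; exists (rcons t (f, x)).
rewrite [walk_end x _]/(walk_end y s) -cats1 walk_cat walk_end_cat wt et /=.
rewrite Gf setUC eqxx /unzip1 /unzip2 !map_cat /= -!/(unzip1 _) -!/(unzip2 _).
by rewrite t1 -cat_cons t2 !cats1 !rev_cons.
Qed.

Lemma walk_split x s z : z \in x :: unzip2 s ->
  exists p r, s = p ++ r /\ walk_end x p = z.
Proof.
elim: s x => [|[f y] s IH] x; first by rewrite inE => /eqP->; exists [::], [::].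
rewrite inE => /orP[/eqP->|]; first by exists [::], ((f, y) :: s).
by case/IH=> p [r [-> <-]]; exists ((f, y) :: p), r.
Qed.

(** A cycle cut open: a path s starting at x, and the edge e that closes it.
    Distinct vertices suffice here, since the edges of a path with distinct
    vertices are distinct. *)
Definition closed_path e x s :=
  [/\ walk G x s, uniq (x :: unzip2 s), e \notin unzip1 s
    & G e = [set walk_end x s; x]].

Lemma closed_path_cycle e x s :
  closed_path e x s -> is_cycle G (e |: walk_edges s).
Proof.
case=> ws us es Ge; exists x, (rcons s (e, x)).
rewrite -cats1 walk_cat walk_end_cat ws /= Ge eqxx; split=> //.
- by case: (s).
- rewrite /unzip1 /unzip2 !map_cat /= -!/(unzip1 _) -!/(unzip2 _) !cats1 !rcons_uniq.
  by rewrite es (path_uniq_edges ws us).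
apply/setP=> f; rewrite !inE /unzip1 map_cat mem_cat -/(unzip1 _) inE.
by rewrite orbC.
Qed.

Lemma closed_path_card e x s :
  closed_path e x s -> #|e |: walk_edges s| = (size s).+1.
Proof.
case=> ws us es Ge; rewrite cardsU1 inE es /walk_edges cardsE.
by rewrite (card_uniqP (path_uniq_edges ws us)) size_map.
Qed.

Lemma closed_path_verts e x s :
  closed_path e x s -> verts G (e |: walk_edges s) = [set v in x :: unzip2 s].
Proof.
case=> ws us es Ge; apply/setP=> v; rewrite inE; apply/bigcupP/idP => [[f]|].
  rewrite !inE => /orP[/eqP->|fs vf]; last by have := walk_edge_mem ws fs vf; rewrite inE.
  rewrite Ge !inE => /orP[]/eqP->; rewrite ?eqxx //.
  by have := mem_last x (unzip2 s); rewrite inE.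
rewrite inE => /orP[/eqP->|/(walk_vertex_edge ws)[f fs vf]].
  by exists e; rewrite ?setU11 // Ge !inE eqxx orbT.
by exists f; rewrite // !inE fs orbT.
Qed.

Lemma path_verts x s : walk G x s -> s != [::] ->
  verts G (walk_edges s) = [set v in x :: unzip2 s].
Proof.
move=> ws s0; apply/setP=> v; rewrite inE; apply/bigcupP/idP => [[f]|].
  by rewrite inE => fs; apply: walk_edge_mem fs.
rewrite inE => /orP[/eqP->|/(walk_vertex_edge ws)[f fs vf]]; last first.
  by exists f; rewrite // inE.
case: s ws s0 => [|[f y] s] //= /andP[/eqP Gf _] _.
by exists f; rewrite ?inE ?eqxx // Gf !inE eqxx.
Qed.

(** Cycles can be read from any of their vertices or edges. *)
Lemma closed_walk_rot x s t :
  [/\ walk G x (s ++ t), walk_end x (s ++ t) = x,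
      uniq (unzip1 (s ++ t)) & uniq (unzip2 (s ++ t))] ->
  [/\ walk G (walk_end x s) (t ++ s),
      walk_end (walk_end x s) (t ++ s) = walk_end x s,
      uniq (unzip1 (t ++ s)), uniq (unzip2 (t ++ s))
    & walk_edges (t ++ s) = walk_edges (s ++ t)].
Proof.
rewrite !walk_cat !walk_end_cat => -[/andP[ws wt] ex u1 u2].
rewrite ex ws wt; split=> //.
- by rewrite /unzip1 map_cat uniq_catC -map_cat.
- by rewrite /unzip2 map_cat uniq_catC -map_cat.
by apply/setP=> f; rewrite !inE /unzip1 !map_cat !mem_cat orbC.
Qed.

Lemma closed_walk_path x e z s :
  walk G x ((e, z) :: s) -> walk_end x ((e, z) :: s) = x ->
  uniq (unzip1 ((e, z) :: s)) -> uniq (unzip2 ((e, z) :: s)) ->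
  [/\ closed_path e z s, walk_end z s = x
    & walk_edges ((e, z) :: s) = e |: walk_edges s].
Proof.
rewrite [walk_end _ _]/(walk_end z s) /= => /andP[/eqP Ge wz] ex /andP[e1 u1] u2.
split=> //; first by split=> //; rewrite Ge -ex.
by apply/setP=> f; rewrite !inE.
Qed.

Lemma cycle_at_edge C e : is_cycle G C -> e \in C ->
  exists x s, closed_path e x s /\ C = e |: walk_edges s.
Proof.
case=> x [s [_ ws es /andP[u1 u2] ->]]; rewrite inE => /mapP[[f z] fs /= ->].
case/splitPr: fs ws es u1 u2 => p r ws es u1 u2.
case: (closed_walk_rot (And4 ws es u1 u2)) => ws' es' u1' u2' <-.
by case: (closed_walk_path ws' es' u1' u2') => cp _ ->; exists z, (r ++ p).
Qed.

Lemma cycle_at_vertex C y : is_cycle G C -> y \in verts G C ->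
  exists e x s, [/\ closed_path e x s, walk_end x s = y
                  & C = e |: walk_edges s].
Proof.
case=> x [s [s0 ws es /andP[u1 u2] ->]] ys.
have /walk_split[p [r [Ds ep]]] : y \in x :: unzip2 s.
  by case/bigcupP: ys => f; rewrite inE => fs; apply: walk_edge_mem fs.
subst s; case: (closed_walk_rot (And4 ws es u1 u2)) => ws' es' u1' u2' <-.
case Dt: (r ++ p) ws' es' u1' u2' => [|[e z] t] ws' es' u1' u2'.
  by case: (p) (r) Dt s0 => [|? ?] [|? ?].
have [cp et ->] := closed_walk_path ws' es' u1' u2'.
by exists e, z, t; rewrite et ep.
Qed.

Lemma cycle_verts0 C : is_cycle G C -> exists v, v \in verts G C.
Proof.
case=> x [[|[e y] s] [// _ /andP[/eqP Ge _] _ _ ->]].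
by exists x; apply/bigcupP; exists e; rewrite ?inE ?eqxx // Ge !inE eqxx.
Qed.

Lemma even_closed_path e x s :
  closed_path e x s -> odd (size s) -> even_circuit G (e |: walk_edges s).
Proof.
move=> cp os; apply: Or31; split; first exact: closed_path_cycle cp.
by rewrite (closed_path_card cp) /= os.
Qed.

Lemma odd_closed_path e x s :
  closed_path e x s -> ~~ odd (size s) -> odd_cycle G (e |: walk_edges s).
Proof.
move=> cp os; split; first exact: closed_path_cycle cp.
by rewrite (closed_path_card cp) /= os.
Qed.

Lemma walk_edges_cat s t : walk_edges (s ++ t) = walk_edges s :|: walk_edges t.
Proof. by apply/setP=> f; rewrite !inE /unzip1 map_cat mem_cat. Qed.

Lemma walk_edges_sub s D :
  {subset unzip1 s <= D} -> walk_edges s \subset D.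
Proof. by move=> sD; apply/subsetP=> f; rewrite inE => /sD. Qed.

Lemma uniq_cat_disj (T : eqType) (s1 s2 : seq T) :
  uniq (s1 ++ s2) -> forall v : T, v \in s1 -> v \in s2 -> False.
Proof.
by rewrite cat_uniq => /and3P[_ /hasPn H _] v v1 /H /negP.
Qed.

(** The edge f closes the initial part p of the path and e closes its final
    part t. If neither cycle is even, they are two odd cycles joined by the
    middle part r, or sharing a vertex if r is empty. *)
Lemma disjoint_returns_even_circuit x (p r t : seq (E * V)) e f D :
  let z' := walk_end x p in let z := walk_end z' r in
  walk G x (p ++ r ++ t) -> uniq (x :: unzip2 (p ++ r ++ t)) ->
  {subset [:: e, f & unzip1 (p ++ r ++ t)] <= D} -> e != f ->
  e \notin unzip1 (p ++ r ++ t) -> f \notin unzip1 (p ++ r ++ t) ->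
  G e = [set walk_end z t; z] -> G f = [set x; z'] ->
  exists Z, even_circuit G Z /\ Z \subset D.
Proof.
move=> z' z ws us sD ef es fs Ge Gf.
have ue := path_uniq_edges ws us.
move: ws; rewrite !walk_cat -/z' -/z => /and3P[wp wr wt].
move: us ue es fs sD; rewrite /unzip1 /unzip2 !map_cat.
rewrite -!/(unzip1 _) -!/(unzip2 _) -cat_cons.
rewrite !mem_cat !negb_or => us ue /and3P[ep er et] /and3P[fp fr ft] sD.
have sub q : q \in e :: f :: unzip1 p ++ unzip1 r ++ unzip1 t -> q \in D by apply: sD.
have disp := uniq_cat_disj us.
have dispe := uniq_cat_disj ue.
move: (us); rewrite cat_uniq => /and3P[up _ urt].
have disr := uniq_cat_disj urt.
move: (urt); rewrite cat_uniq => /and3P[ur _ ut].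
have zr : z \in z' :: unzip2 r by apply: mem_last.
have z'p : z' \in x :: unzip2 p by apply: mem_last.
have z'r : z' \notin unzip2 r ++ unzip2 t by apply/negP=> /(disp _ z'p).
have uz't : z' \notin unzip2 t by apply: contra z'r; rewrite mem_cat orbC => ->.
have uzt : z \notin unzip2 t.
  by move: zr; rewrite inE => /orP[/eqP->//|zr]; apply/negP=> /(disr _ zr).
have cpB : closed_path f x p by split=> //; rewrite Gf setUC.
have cpA : closed_path e z t by split=> //=; rewrite uzt.
have sBD : f |: walk_edges p \subset D.
  apply/subsetP=> g; rewrite !inE => /orP[/eqP->|gp]; apply: sub.
    by rewrite !inE eqxx orbT.
  by rewrite !inE mem_cat gp !orbT.
have sAD : e |: walk_edges t \subset D.
  apply/subsetP=> g; rewrite !inE => /orP[/eqP->|gp]; apply: sub.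
    by rewrite !inE eqxx.
  by rewrite !inE !mem_cat gp !orbT.
have [op|op] := boolP (odd (size p)).
  by exists (f |: walk_edges p); split=> //; apply: even_closed_path cpB op.
have [ot|ot] := boolP (odd (size t)).
  by exists (e |: walk_edges t); split=> //; apply: even_closed_path cpA ot.
have ocB := odd_closed_path cpB op; have ocA := odd_closed_path cpA ot.
have vB := closed_path_verts cpB; have vA := closed_path_verts cpA.
have [r0|r0] := eqVneq r [::].
  have zz' : z = z' by rewrite /z r0.
  exists ((f |: walk_edges p) :|: (e |: walk_edges t)).
  split; last by rewrite subUset sBD.
  apply: Or32; exists (f |: walk_edges p), (e |: walk_edges t); split=> //.
    rewrite -setI_eq0; apply/eqP/setP => g; rewrite !inE; apply/negP.
    case/andP=> /orP[/eqP->|gp] /orP[/eqP ge|gt].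
    - by rewrite ge eqxx in ef.
    - by rewrite gt in ft.
    - by rewrite -ge gp in ep.
    - by apply: (dispe g) => //; rewrite mem_cat gt orbT.
  apply/eqP/cards1P; exists z; apply/setP=> v; rewrite vB vA !in_set ?in_set1.
  apply/andP/idP=> [[vp]|/eqP->]; last by rewrite mem_head zz' z'p.
  rewrite inE => /orP[//|vt]; have := disp v vp.
  by rewrite mem_cat vt orbT => /(_ isT).
have zr' : z \in unzip2 r.
  by rewrite /z {1}/walk_end; case: (r) r0 => [|[g y] r'] //= _; apply: mem_last.
exists ((f |: walk_edges p) :|: walk_edges r :|: (e |: walk_edges t)).
split; last first.
  rewrite subUset sAD andbT subUset sBD /=; apply: walk_edges_sub => g gr.
  by apply: sub; rewrite !inE !mem_cat gr !orbT.
apply: Or33; exists (f |: walk_edges p), (e |: walk_edges t), (walk_edges r), z', z.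
have vr := path_verts wr r0.
split=> //.
- rewrite -setI_eq0; apply/eqP/setP=> v; rewrite vB vA !in_set; apply/negP.
  case/andP=> vp; rewrite inE => /orP[/eqP vz|vt]; apply: (disp v vp); rewrite mem_cat.
    by rewrite vz zr'.
  by rewrite vt orbT.
- split; last first.
    case: (r) r0 => [|[g y] r'] //= _; rewrite card_gt0; apply/set0Pn.
    by exists g; rewrite !inE eqxx.
  exists r; split=> //=.
  by rewrite ur andbT; apply: contra z'r; rewrite mem_cat => ->.
split; apply/setP=> v; rewrite vr ?vB ?vA !in_set ?in_set1.
  apply/andP/eqP=> [[]|->]; last by rewrite mem_head.
  rewrite inE => /orP[/eqP//|vr'] vp.
  by have := disp v vp; rewrite mem_cat vr' => /(_ isT).
apply/andP/eqP=> [[]|->]; last by rewrite mem_head.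
rewrite !inE => /orP[/eqP->|vr'] /orP[/eqP//|vt]; first by rewrite vt in uz't.
by have := disr v vr' vt.
Qed.

(** Now f closes p ++ r and e closes r ++ t. These cycles form a theta graph; the
    third cycle follows p backwards, then f, then t, and is closed by e. The
    three lengths have an even sum, so one of them is even. *)
Lemma crossing_returns_even_circuit x (p r t : seq (E * V)) e f D :
  let z := walk_end x p in let z' := walk_end z r in
  walk G x (p ++ r ++ t) -> uniq (x :: unzip2 (p ++ r ++ t)) -> r != [::] ->
  {subset [:: e, f & unzip1 (p ++ r ++ t)] <= D} -> e != f ->
  e \notin unzip1 (p ++ r ++ t) -> f \notin unzip1 (p ++ r ++ t) ->
  G e = [set walk_end z' t; z] -> G f = [set x; z'] ->
  exists Z, even_circuit G Z /\ Z \subset D.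
Proof.
move=> z z' ws us r0 sD ef es fs Ge Gf.
have ue := path_uniq_edges ws us.
move: ws; rewrite !walk_cat -/z -/z' => /and3P[wp wr wt].
move: us ue es fs sD; rewrite /unzip1 /unzip2 !map_cat.
rewrite -!/(unzip1 _) -!/(unzip2 _) -cat_cons.
rewrite !mem_cat !negb_or => us ue /and3P[ep er et] /and3P[fp fr ft] sD.
have sub q : q \in e :: f :: unzip1 p ++ unzip1 r ++ unzip1 t -> q \in D by apply: sD.
have disp := uniq_cat_disj us.
move: (us); rewrite cat_uniq => /and3P[up _ urt].
have disr := uniq_cat_disj urt.
move: (urt); rewrite cat_uniq => /and3P[ur _ ut].
have zp : z \in x :: unzip2 p by apply: mem_last.
have zr' : z' \in unzip2 r.
  by rewrite /z' {1}/walk_end; case: (r) r0 => [|[g y] r'] //= _; apply: mem_last.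
have zrt : z \notin unzip2 r ++ unzip2 t by apply/negP=> /(disp _ zp).
have cpB : closed_path f x (p ++ r).
  split; rewrite ?walk_cat ?wp //.
  - move: us; rewrite catA cat_uniq => /andP[+ _].
    by rewrite cat_cons /unzip2 map_cat.
  - by rewrite /unzip1 map_cat mem_cat negb_or fp.
  - by rewrite walk_end_cat Gf setUC.
have cpA : closed_path e z (r ++ t).
  split; rewrite ?walk_cat ?wr //.
  - by rewrite /unzip2 map_cat /= zrt.
  - by rewrite /unzip1 map_cat mem_cat negb_or er.
  - by rewrite walk_end_cat.
have [p' [wp' ep' e1 v1]] := walk_rev wp; rewrite -/z in wp' ep' v1.
have cpC : closed_path e z (p' ++ (f, z') :: t).
  split.
  - by rewrite walk_cat wp' /= ep' Gf eqxx.
  - rewrite /unzip2 map_cat -!/(unzip2 _) -cat_cons v1 /= cat_uniq rev_uniq up /=.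
    rewrite ut andbT mem_rev negb_or -andbA; apply/and3P; split.
    + by apply/negP=> /disp; rewrite mem_cat zr' => /(_ isT).
    + apply/hasPn=> v vt; rewrite /= mem_rev; apply/negP=> /disp.
      by rewrite mem_cat vt orbT => /(_ isT).
    + by apply/negP=> /(disr _ zr').
  - by rewrite /unzip1 map_cat mem_cat -!/(unzip1 _) e1 mem_rev /= inE !negb_or ep ef.
  - by rewrite walk_end_cat Ge.
have sBD : f |: walk_edges (p ++ r) \subset D.
  apply/subsetP=> g; rewrite walk_edges_cat !inE => H; apply: sub.
  by case/or3P: H => [/eqP->|gp|gr]; rewrite !inE ?mem_cat ?eqxx ?gp ?gr ?orbT.
have sAD : e |: walk_edges (r ++ t) \subset D.
  apply/subsetP=> g; rewrite walk_edges_cat !inE => H; apply: sub.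
  by case/or3P: H => [/eqP->|gr|gt]; rewrite !inE ?mem_cat ?eqxx ?gr ?gt ?orbT.
have sCD : e |: walk_edges (p' ++ (f, z') :: t) \subset D.
  apply/subsetP=> g; rewrite walk_edges_cat !inE e1 mem_rev => H; apply: sub.
  by case/or4P: H => [/eqP->|gr|/eqP->|gt]; rewrite !inE ?mem_cat ?eqxx ?gr ?gt ?orbT.
have [op|op] := boolP (odd (size (p ++ r))).
  by exists (f |: walk_edges (p ++ r)); split=> //; apply: even_closed_path cpB op.
have [ot|ot] := boolP (odd (size (r ++ t))).
  by exists (e |: walk_edges (r ++ t)); split=> //; apply: even_closed_path cpA ot.
exists (e |: walk_edges (p' ++ (f, z') :: t)); split=> //.
apply: even_closed_path cpC _; move: op ot.
have := congr1 size e1; rewrite size_rev !size_map !size_cat /= => ->.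
by rewrite addnS /= !oddD; do 3!case: (odd _).
Qed.

(** If both ends of a path have a further edge returning to it, the two return
    points occur on the path in one order or the other. *)
Lemma two_returns_even_circuit x s e f z z' D :
  walk G x s -> uniq (x :: unzip2 s) ->
  {subset [:: e, f & unzip1 s] <= D} -> e != f ->
  e \notin unzip1 s -> f \notin unzip1 s ->
  z \in x :: unzip2 s -> z' \in x :: unzip2 s ->
  G e = [set walk_end x s; z] -> G f = [set x; z'] ->
  exists Z, even_circuit G Z /\ Z \subset D.
Proof.
move=> ws us sD ef es fs /walk_split[p [q [Ds ez]]] /walk_split[p' [q' [Ds' ez']]] Ge Gf.
have [le_p'p|lt_pp'] := leqP (size p') (size p).
  have Dp : p = p' ++ drop (size p') p.
    by rewrite -{1}[p](cat_take_drop (size p')) -(takel_cat q le_p'p) -Ds Ds' take_size_cat.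
  move: (drop _ p) Dp => r Dp; subst p; rewrite -catA in Ds.
  move: ws us sD es fs Ge; rewrite Ds => ws us sD es fs Ge.
  apply: (@disjoint_returns_even_circuit x p' r q e f D) => //.
    by rewrite Ge -ez !walk_end_cat.
  by rewrite ez'.
have Dp : p' = p ++ drop (size p) p'.
  rewrite -{1}[p'](cat_take_drop (size p)) -(takel_cat q' (ltnW lt_pp')).
  by rewrite -Ds' Ds take_size_cat.
have r0 : drop (size p) p' != [::] by rewrite -size_eq0 size_drop subn_eq0 -ltnNge.
move: (drop _ p') Dp r0 => r Dp r0; subst p'; rewrite -catA in Ds'.
move: ws us sD es fs Ge; rewrite Ds' => ws us sD es fs Ge.
apply: (@crossing_returns_even_circuit x p r q' e f D) => //.
  by rewrite Ge !walk_end_cat ez.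
by rewrite Gf -ez' walk_end_cat.
Qed.

End Walks.

(** * Dependence of incidence vectors and even circuits *)

Section IncidenceDependence.
Variables (K : fieldType) (charK0 : [pchar K] =i pred0).
Variables (V E : finType) (G : mgraph V E).
Implicit Types (x y z v : V) (e f g q : E) (s t : seq (E * V)) (C D Z F : {set E}).
Implicit Types (l : V -> K).

Definition incidence e v : K := (v \in G e)%:R.

Lemma two_neq0 : 2%:R != 0 :> K.
Proof. by have /pcharf0P-> := charK0. Qed.

(** For a loop the left-hand value is l x and the right-hand one is 2 l x: they
    vanish together because the characteristic is not 2. *)
Lemma value_ends l e x y : G e = [set x; y] ->
  (value incidence l e == 0) = (l x + l y == 0).
Proof.
move=> Ge; have -> : value incidence l e = \sum_(v in G e) l v.
  rewrite [RHS]big_mkcond; apply: eq_bigr => v _; rewrite /incidence.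
  by case: ifP; rewrite ?mulr1 ?mulr0.
have [xy|xy] := eqVneq x y.
  rewrite Ge xy setUid big_set1 -mulr2n -mulr_natr mulf_eq0.
  by rewrite (negPf two_neq0) orbF.
by rewrite Ge big_setU1 ?inE // big_set1.
Qed.

Lemma value_ends0 l e x y : G e = [set x; y] ->
  value incidence l e = 0 -> l y = - l x.
Proof. by move=> Ge /eqP; rewrite (value_ends _ Ge) addrC addr_eq0 => /eqP. Qed.

Lemma walk_kills l x s : walk G x s -> kills incidence l (walk_edges s) ->
  l (walk_end x s) = (-1) ^+ size s * l x.
Proof.
elim: s x => [|[e y] s IH] x /=; first by rewrite mul1r.
case/andP=> /eqP Ge ws lk; rewrite -[walk_end x _]/(walk_end y s).
rewrite IH // => [|q]; last by rewrite inE => qs; apply: lk; rewrite !inE qs orbT.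
rewrite (value_ends0 Ge) ?exprS; last by rewrite lk // !inE eqxx.
by rewrite mulrN mulN1r mulNr.
Qed.

Lemma closed_path_kills l e x s :
  closed_path G e x s -> kills incidence l (walk_edges s) ->
  (value incidence l e == 0) = (((-1) ^+ size s + 1) * l x == 0).
Proof.
by case=> ws us es Ge lk; rewrite (value_ends _ Ge) (walk_kills ws lk) mulrDl mul1r.
Qed.

(** Going once around an odd cycle changes the sign of the label. *)
Lemma odd_cycle_kills l C v : odd_cycle G C -> kills incidence l C ->
  v \in verts G C -> l v = 0.
Proof.
case=> cC oC lk vC; have [e [x [s [cp es DC]]]] := cycle_at_vertex cC vC.
have lks : kills incidence l (walk_edges s).
  by apply: killsS lk; rewrite DC subsetUr.
have := oC; rewrite DC (closed_path_card cp) /= => os.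
have := closed_path_kills cp lks; rewrite lk ?DC ?setU11 // eqxx.
rewrite -signr_odd (negPf os) expr0 mulf_eq0 (negPf two_neq0) => /esym/eqP lx.
by case: cp => ws _ _ _; rewrite -es (walk_kills ws lks) lx mulr0.
Qed.

(** The label of v propagates along the cycle opened at an edge incident to v, so
    its vanishing makes this edge dependent on the others. *)
Lemma cycle_edge_spanned Z C v : is_cycle G C -> C \subset Z -> v \in verts G C ->
  (forall e l, e \in C -> kills incidence l (Z :\ e) -> l v = 0) ->
  exists2 e, e \in Z & spanned incidence (Z :\ e) e.
Proof.
move=> cC sCZ vC lv0; have [e [x [s [cp es DC]]]] := cycle_at_vertex cC vC.
exists e; first by apply: (subsetP sCZ); rewrite DC setU11.
apply/spannedP=> l lk; case: (cp) => ws _ ess Ge.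
have lks : kills incidence l (walk_edges s).
  apply: killsS lk; apply/subsetP=> q qs; rewrite in_setD1 (subsetP sCZ) ?DC ?inE.
    by rewrite andbT; apply: contraNneq ess => <-; rewrite inE in qs.
  by move: qs; rewrite inE => ->; rewrite orbT.
have := lv0 e l; rewrite DC setU11 => /(_ isT lk).
rewrite -es (walk_kills ws lks) => /eqP; rewrite mulf_eq0 signr_eq0 => /eqP lx.
by apply/eqP; rewrite (closed_path_kills cp lks) lx mulr0.
Qed.

(** Along an even cycle minus an edge the labels of the two ends are opposite.
    In the other two cases, the second odd cycle forces the label to vanish on
    itself, hence, through the bridge if there is one, at a vertex of the first
    cycle. *)
Lemma even_circuit_dependent Z :
  even_circuit G Z -> exists2 e, e \in Z & spanned incidence (Z :\ e) e.
Proof.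
case=> [[cZ eZ]|[C1 [C2 [[c1 o1] oc2 dC /eqP/cards1P[v vC] ->]]]|].
- have [v vZ] := cycle_verts0 cZ.
  have [e [x [s [cp es DZ]]]] := cycle_at_vertex cZ vZ.
  exists e; first by rewrite DZ setU11.
  apply/spannedP => l lk; have lks : kills incidence l (walk_edges s).
    apply: killsS lk; rewrite DZ setU1K //.
    by case: cp => _ _ + _; rewrite inE.
  apply/eqP; rewrite (closed_path_kills cp lks) -signr_odd.
  move: eZ; rewrite DZ (closed_path_card cp) /= negbK => ->.
  by rewrite expr1 addNr mul0r.
- have /setIP[v1 v2] : v \in verts G C1 :&: verts G C2 by rewrite vC set11.
  apply: (@cycle_edge_spanned _ C1 v) => //; first exact: subsetUl.
  move=> e l e1 lk; apply: (odd_cycle_kills oc2) v2; apply: killsS lk.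
  apply/subsetP=> q q2; rewrite !inE q2 orbT andbT.
  by apply: contraTneq q2 => ->; rewrite (disjointFr dC).
case=> C1 [C2 [P [x [y [[[c1 o1] oc2] dC [[s [ws es us DP]] P0] [v1 v2] ->]]]]].
have xC1 : x \in verts G C1.
  by have /setIP[] : x \in verts G P :&: verts G C1 by rewrite v1 set11.
have yC2 : y \in verts G C2.
  by have /setIP[] : y \in verts G P :&: verts G C2 by rewrite v2 set11.
apply: (@cycle_edge_spanned _ C1 x) => //; first by rewrite -setUA subsetUl.
move=> e l eC1 lk.
have sub1 : G e \subset verts G C1 by apply: bigcup_sup.
have eC2 : e \notin C2.
  apply/negP=> eC2; have /andP[] := ends_card G e; rewrite card_gt0 => /set0Pn[v ve] _.
  have := disjointFr dC (subsetP sub1 v ve).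
  by rewrite (subsetP (bigcup_sup e _) v ve).
have eP : e \notin P.
  apply/negP=> eP.
  have sGe : G e \subset [set x].
    by rewrite -v1 subsetI sub1 andbT; apply: bigcup_sup.
  have loop z y' : G e = [set z; y'] -> z = y'.
    move=> Ge; have : z \in [set x] by rewrite (subsetP sGe) // Ge !inE eqxx.
    have : y' \in [set x] by rewrite (subsetP sGe) // Ge !inE eqxx orbT.
    by move=> /set1P-> /set1P->.
  move: eP; rewrite DP inE; elim: (s) (x) ws us => [|[f z] t IH] u //=.
  rewrite inE => /andP[/eqP Gf wt] /and3P[uz zt ut] /orP[/eqP ef|/(IH z)]; last first.
    by apply=> //=; rewrite zt ut.
  by move: uz; rewrite (loop u z) ?inE ?eqxx // ef.
have ly : l y = 0.
  apply: (odd_cycle_kills oc2) yC2; apply: killsS lk.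
  by apply/subsetP=> q q2; rewrite !inE q2 orbT andbT; apply: contraNneq eC2 => <-.
have lkP : kills incidence l (walk_edges s).
  apply: killsS lk; rewrite -DP; apply/subsetP=> q qP; rewrite !inE qP orbT /= andbT.
  by apply: contraNneq eP => <-.
have := walk_kills ws lkP; rewrite es ly => /esym/eqP.
by rewrite mulf_eq0 signr_eq0 => /eqP.
Qed.

(** When the closing edge of a path makes an odd cycle, these labels do not
    annihilate it, which shows that it is not spanned by the path. They vanish
    off the path so as to annihilate also the edges that do not meet it. *)
Lemma alternating_labels x s : walk G x s -> uniq (x :: unzip2 s) ->
  exists l : V -> K, [/\ kills incidence l (walk_edges s), l x = 1,
    l (walk_end x s) = (-1) ^+ size s
    & forall v, v \notin x :: unzip2 s -> l v = 0].
Proof.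
move=> ws us.
suff [l [lk lx l0]] : exists l : V -> K, [/\ kills incidence l (walk_edges s),
    l x = 1 & forall v, v \notin x :: unzip2 s -> l v = 0].
  by exists l; rewrite (walk_kills ws lk) lx mulr1.
elim: s x ws us => [|[e y] s IH] x.
  exists (fun v => (v == x)%:R); rewrite eqxx; split=> // [q|v].
    by rewrite inE.
  by rewrite inE => /negPf->.
move=> /andP[/eqP Ge ws] /andP[xs us]; have [l [lk ly l0]] := IH y ws us.
exists (fun v => if v == x then 1 else - l v); rewrite eqxx; split=> // [q|v].
  rewrite !inE => /orP[/eqP->|qs].
    apply/eqP; rewrite (value_ends _ Ge) eqxx ifN ?ly ?subrr //.
    by apply: contraNneq xs => <-; rewrite inE eqxx.
  have [u [w Gq]] : exists u w, G q = [set u; w].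
    have /andP[] := ends_card G q; rewrite card_gt0 => /set0Pn[u uq] _.
    by have [w Gq] := edge_other uq; exists u, w.
  have nx u' : u' \in G q -> u' != x.
    by move=> /(walk_edge_mem ws qs); apply: contraTneq => ->.
  apply/eqP; rewrite (value_ends _ Gq) !ifN ?nx ?Gq ?set21 ?set22 //.
  by rewrite -opprD oppr_eq0 -(value_ends _ Gq) lk // inE.
by rewrite inE negb_or => /andP[/negPf-> /l0->]; rewrite oppr0.
Qed.

Section MinimumDegree.
Variables (D : {set E}) (w : E -> K).
Hypotheses (w_neq0 : {in D, forall q, w q != 0})
  (w_rel : forall v, \sum_(q in D) w q * incidence q v = 0).

(** Otherwise the relation would have a single nonzero term at v. *)
Lemma another_edge v q : q \in D -> v \in G q ->
  exists2 q', q' \in D & (q' != q) /\ (v \in G q').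
Proof.
move=> qD vq; have [//|no] := EM (exists2 q', q' \in D & (q' != q) /\ (v \in G q')).
have /eqP := w_rel v; rewrite (big_setD1 q) //= big1 => [|q' /setD1P[nq q'D]].
  by rewrite addr0 /incidence vq mulr1 (negPf (w_neq0 qD)).
rewrite /incidence; case: (boolP (v \in G q')) => vq'; last by rewrite mulr0.
by case: no; exists q'.
Qed.

Definition path_in x s :=
  [/\ walk G x s, uniq (x :: unzip2 s), {subset unzip1 s <= D} & x \in verts G D].

Lemma longest_path : D != set0 -> exists n,
  (exists x s, path_in x s /\ size s = n) /\
  forall x s, path_in x s -> (size s <= n)%N.
Proof.
case/set0Pn=> e eD; pose P n := `[< exists x s, path_in x s /\ size s = n >].
have exP : exists n, P n.
  have /andP[] := ends_card G e; rewrite card_gt0 => /set0Pn[v ve] _.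
  exists 0; apply/asboolP; exists v, [::]; split=> //; split=> //.
  by apply/bigcupP; exists e.
have ubP n : P n -> (n <= #|V|)%N.
  move=> /asboolP[x [s [[_ us _ _] <-]]].
  have := max_card (mem (x :: unzip2 s)); rewrite (card_uniqP us) /= size_map.
  exact: ltnW.
exists (ex_maxn exP ubP); case: ex_maxnP => n /asboolP Pn max_n; split=> // x s ps.
by apply: max_n; apply/asboolP; exists x, s.
Qed.

Lemma path_in_rev x s : path_in x s -> exists t,
  [/\ path_in (walk_end x s) t, walk_end (walk_end x s) t = x, size t = size s,
      unzip1 t =i unzip1 s & walk_end x s :: unzip2 t =i x :: unzip2 s].
Proof.
case=> ws us sD xD; have [t [wt et t1 t2]] := walk_rev ws; exists t.
have t1i : unzip1 t =i unzip1 s by move=> q; rewrite t1 mem_rev.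
have t2i : walk_end x s :: unzip2 t =i x :: unzip2 s by move=> q; rewrite t2 mem_rev.
split=> //; last by have := congr1 size t1; rewrite size_rev !size_map.
split=> //; first by rewrite t2 rev_uniq.
  by move=> q; rewrite t1i => /sD.
have : walk_end x s \in x :: unzip2 s by apply: mem_last.
rewrite inE => /orP[/eqP->//|/(walk_vertex_edge ws)[q qs vq]].
by apply/bigcupP; exists q; first exact: sD.
Qed.

Lemma end_edge x s : path_in x s ->
  exists e, [/\ e \in D, e \notin unzip1 s & walk_end x s \in G e].
Proof.
case=> ws us sD xD; case/lastP: s ws us sD => [|s [f y]] ws us sD.
  by case/bigcupP: xD => e eD xe; exists e.
move: ws us sD; rewrite -cats1 walk_cat walk_end_cat /= andbT => /andP[ws /eqP Gf].
rewrite /unzip1 /unzip2 !map_cat /= -!/(unzip1 _) -!/(unzip2 _) => us sD.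
have [||e eD [ef ye]] := @another_edge y f; rewrite ?Gf ?set22 //.
  by apply: sD; rewrite mem_cat inE eqxx orbT.
exists e; split=> //; rewrite mem_cat negb_or inE ef andbT.
apply/negP=> es; have := walk_edge_mem ws es ye.
have : uniq ((x :: unzip2 s) ++ [:: y]) by [].
by rewrite cats1 rcons_uniq => /andP[/negPf->].
Qed.

Lemma end_edge_returns n x s e :
  (forall x s, path_in x s -> (size s <= n)%N) -> path_in x s -> size s = n ->
  e \in D -> walk_end x s \in G e ->
  exists2 z, z \in x :: unzip2 s & G e = [set walk_end x s; z].
Proof.
move=> max_n [ws us sD xD] sn eD /edge_other[z Ge]; exists z => //.
apply/negPn/negP=> zs; have := max_n x (rcons s (e, z)); rewrite size_rcons sn ltnn.
suff p : path_in x (rcons s (e, z)) by move=> /(_ p).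
split=> //.
- by rewrite -cats1 walk_cat ws /= Ge eqxx.
- by rewrite /unzip2 map_rcons -rcons_cons rcons_uniq zs.
by move=> q; rewrite /unzip1 map_rcons mem_rcons inE => /orP[/eqP->|/sD].
Qed.

Lemma start_edge n x s :
  (forall x s, path_in x s -> (size s <= n)%N) -> path_in x s -> size s = n ->
  exists f z, [/\ f \in D, f \notin unzip1 s, z \in x :: unzip2 s
                & G f = [set x; z]].
Proof.
move=> max_n /path_in_rev[t [pt et szt t1 t2]] sn.
have [f [fD ft xf]] := end_edge pt.
have [|z zt Gf] := end_edge_returns max_n pt _ fD xf; first by rewrite szt.
by exists f, z; split=> //; [rewrite -t1 | rewrite -t2 | rewrite Gf et].
Qed.

(** On a longest path, the additional edges at both ends return to the path. If
    they differ, there is an even circuit. If they are the same edge, it closes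
    the path to a cycle, which may be assumed odd. If some vertex of the cycle
    lies on a further edge g of D, opening the cycle at this vertex gives another
    longest path whose last vertex has two additional edges, of which at least
    one differs from the additional edge at the start. If there is no such g,
    the relation restricts to the odd cycle, whose edges are independent. *)
Lemma relation_even_circuit : D != set0 ->
  exists Z, even_circuit G Z /\ Z \subset D.
Proof.
move=> /longest_path[n [[x [s [ps sn]]] max_n]].
have [f [z' [fD fs z's Gf]]] := start_edge max_n ps sn.
have [e [eD es xe]] := end_edge ps.
have [z zs Ge] := end_edge_returns max_n ps sn eD xe.
have subD e' f' t : e' \in D -> f' \in D -> {subset unzip1 t <= D} ->
  {subset [:: e', f' & unzip1 t] <= D}.
  by move=> e'D f'D tD q; rewrite !inE => /or3P[/eqP->|/eqP->|/tD].
have [ef|ef] := eqVneq e f; last first.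
  case: ps => ws us sD _.
  by apply: (two_returns_even_circuit ws us) Ge Gf => //; apply: subD.
have cp : closed_path G e x s.
  case: (ps) => ws us _ _; split=> //; rewrite Ge; congr [set _; _].
  have : x \in G e by rewrite ef Gf set21.
  rewrite Ge !inE => /orP[/eqP xe'|/eqP//].
  move: zs us; rewrite xe' /walk_end; case: (s) => [|a t]; first by rewrite inE => /eqP.
  by rewrite /= mem_last.
pose C := e |: walk_edges s.
have sCD : C \subset D.
  case: ps => _ _ sD _; apply/subsetP=> q; rewrite !inE => /orP[/eqP->//|/sD//].
have [on|on] := boolP (odd n).
  by exists C; split=> //; apply: even_closed_path cp _; rewrite sn.
have [[y [g [ys gD gC yg]]]|no] :=
  EM (exists y g, [/\ y \in verts G C, g \in D, g \notin C & y \in G g]).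
  have [e1 [x1 [s1 [cp1 ey DC]]]] := cycle_at_vertex (closed_path_cycle cp) ys.
  have s1n : size s1 = n.
    have := closed_path_card cp1; rewrite -DC (closed_path_card cp) sn.
    by case.
  have sC1 q : q \in unzip1 s1 -> q \in C by rewrite /C DC !inE orbC => ->.
  have e1C : e1 \in C by rewrite /C DC setU11.
  case: (cp1) => w1 u1 e1s Ge1.
  have p1 : path_in x1 s1.
    split=> // [q /sC1 /(subsetP sCD)//|].
    by apply/bigcupP; exists e1; [exact: (subsetP sCD) | rewrite Ge1 set22].
  have [f1 [z1 [f1D f1s z1s Gf1]]] := start_edge max_n p1 s1n.
  have [z2 z2s Gg] : exists2 z, z \in x1 :: unzip2 s1 & G g = [set walk_end x1 s1; z].
    by apply: end_edge_returns max_n p1 s1n gD _; rewrite ey.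
  have gs1 : g \notin unzip1 s1 by apply: contra gC => /sC1.
  have e1g : e1 != g by apply: contraNneq gC => <-.
  have [f1g|gf1] := eqVneq g f1; last first.
    apply: (two_returns_even_circuit w1 u1 _ gf1) Gg Gf1 => //.
    by apply: subD => //; case: p1.
  apply: (two_returns_even_circuit w1 u1 _ e1g) Ge1 _ => //.
  - by apply: subD => //; [exact: (subsetP sCD) | case: p1].
  - exact: mem_head.
  - exact: z1s.
  by rewrite f1g.
case: (ps) => ws us _ _; have [l [lk lx le l0]] := alternating_labels ws us.
have := relation_value l w_rel; rewrite (big_setD1 e) //= big1 ?addr0.
  move/eqP; rewrite mulf_eq0 (negPf (w_neq0 eD)) (closed_path_kills cp lk) lx mulr1.
  by rewrite sn -signr_odd (negPf on) (negPf two_neq0).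
move=> q /setD1P[qe qD]; have [qs|qs] := boolP (q \in walk_edges s).
  by rewrite lk ?mulr0.
rewrite /value big1 ?mulr0 // => v _; rewrite /incidence.
case: (boolP (v \in G q)) => vq; last by rewrite mulr0.
rewrite mulr1 l0 //; apply/negP=> vs; apply: no; exists v, q; split=> //.
  by rewrite (closed_path_verts cp) inE.
by rewrite in_setU1 negb_or qe.
Qed.

End MinimumDegree.

Lemma dependent_even_circuit D e : e \in D -> spanned incidence (D :\ e) e ->
  exists Z, even_circuit G Z /\ Z \subset D.
Proof.
move=> eD /(dependent_relation eD)[w [we w0]].
pose D' := [set q in D | w q != 0].
have [|||Z [ecZ sZ]] := @relation_even_circuit D' w.
- by move=> q; rewrite inE => /andP[].
- move=> v; apply: etrans (w0 v); rewrite [RHS](bigID (fun q => w q == 0)) /=.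
  rewrite [X in _ = X + _]big1 ?add0r => [|q /andP[_ /eqP->]]; last by rewrite mul0r.
  by apply: eq_bigl => q; rewrite inE.
- by apply/set0Pn; exists e; rewrite inE eD.
exists Z; split=> //; apply: subset_trans sZ _.
by apply/subsetP=> q; rewrite inE => /andP[].
Qed.

End IncidenceDependence.

(** * Independent sets are odd-circle pseudoforests *)

Section PseudoforestsAreIndependent.
Variables (K : fieldType) (charK0 : [pchar K] =i pred0).
Variables (V E : finType) (G : mgraph V E).
Implicit Types (x y z u v : V) (e q : E) (s : seq (E * V)) (C F S Z : {set E}).
Local Notation incidence := (@incidence K V E G).

Lemma adj_connect_sym S : connect_sym (adj G S).
Proof.
apply: sym_connect_sym => x y; apply: eq_existsb => e.
by rewrite setUC.
Qed.

Lemma comp_connect F x u : u \in comp_verts G F x ->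
  connect (adj G (comp_edges G F x)) x u.
Proof.
suff lift p y : y \in comp_verts G F x -> path (adj G F) y p ->
    connect (adj G (comp_edges G F x)) y (last y p).
  by rewrite inE => /connectP[p xp ->]; apply: lift; rewrite ?inE.
elim: p y => [|z p IH] y //= yx /andP[/exists_inP[e eF /eqP Ge] zp].
have zx : z \in comp_verts G F x.
  rewrite inE in yx; rewrite inE (connect_trans yx) // connect1 //.
  by apply/exists_inP; exists e; rewrite ?Ge.
apply: connect_trans (IH _ zx zp); apply: connect1; apply/exists_inP.
exists e; rewrite ?Ge // inE eF /=; apply/subsetP=> v.
by rewrite Ge => /set2P[]->.
Qed.

Lemma comp_connected F x : connected_graph G (comp_verts G F x) (comp_edges G F x).
Proof.
split=> [|u v /comp_connect xu /comp_connect].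
  by apply/set0Pn; exists x; rewrite inE.
by apply: connect_trans; rewrite adj_connect_sym.
Qed.

Lemma comp_edges_sub F x : comp_edges G F x \subset F.
Proof. by apply/subsetP=> e; rewrite inE => /andP[]. Qed.

Lemma comp_cycle_verts F x C v :
  C \subset comp_edges G F x -> v \in verts G C -> v \in comp_verts G F x.
Proof.
move=> /subsetP sC /bigcupP[e /sC]; rewrite inE => /andP[_ /subsetP sGe] /sGe.
exact.
Qed.

Definition independent F := forall e, e \in F -> ~~ spanned incidence (F :\ e) e.

Lemma independent_no_even_circuit F Z :
  independent F -> Z \subset F -> ~ even_circuit G Z.
Proof.
move=> indF sZF /(even_circuit_dependent charK0)[e eZ].
apply/negP; apply: contra (indF e (subsetP sZF e eZ)).
by apply: spannedS; apply: setSD.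
Qed.

Lemma independent_odd_cycle F C : independent F -> C \subset F -> is_cycle G C ->
  odd_cycle G C.
Proof.
move=> indF sC cC; split=> //; apply/negPn/negP=> eC.
by apply: (independent_no_even_circuit indF sC); apply: Or31.
Qed.

(** Suppose e lies on C' but not on C. A labeling killing the other edges vanishes
    on the odd cycle C. It then vanishes on the whole component: across e itself
    the vanishing is transported by the rest of C'. So e is dependent on the
    other edges. *)
Lemma independent_cycle_sub F x C C' : independent F ->
  cycle_in G C (comp_edges G F x) -> cycle_in G C' (comp_edges G F x) ->
  C' \subset C.
Proof.
move=> indF [cC sC] [cC' sC']; apply/subsetP => e eC'; apply/negPn/negP => eC.
set S := comp_edges G F x in sC sC'.
have eS := subsetP sC' e eC'; have eF := subsetP (comp_edges_sub F x) e eS.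
apply/negP: (indF e eF); rewrite negbK.
apply: (@spannedS _ _ _ _ (S :\ e)); first exact: setSD (comp_edges_sub F x).
apply/spannedP=> l lk.
have [y [s [cp DC']]] := cycle_at_edge cC' eC'; case: (cp) => ws _ es Ge.
have lks : kills incidence l (walk_edges s).
  apply: killsS lk; apply/subsetP=> q qs; rewrite in_setD1.
  rewrite (subsetP sC') ?DC' ?in_setU1 ?qs ?orbT // andbT.
  by apply: contraNneq es => <-; rewrite inE in qs.
have le := walk_kills charK0 ws lks.
have [v0 v0C] := cycle_verts0 cC.
have lv0 : l v0 = 0.
  have oC := independent_odd_cycle indF (subset_trans sC (comp_edges_sub F x)) cC.
  apply: (odd_cycle_kills charK0 oC _ v0C); apply: killsS lk.
  by rewrite subsetD1 sC.
have l0 u : connect (adj G S) v0 u -> l u = 0.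
  case/connectP=> p; elim: p v0 lv0 {v0C} => [|z p IH] v lv /=; first by move=> _ ->.
  case/andP=> /exists_inP[q qS /eqP Gq]; apply: IH.
  have [qe|qe] := eqVneq q e; last first.
    by rewrite (value_ends0 charK0 Gq) ?lv ?oppr0 // lk // in_setD1 qe.
  have ly : l y = 0.
    have : v \in G e by rewrite -qe Gq set21.
    rewrite Ge => /set2P[] Dv; last by rewrite -Dv.
    by move/eqP: le; rewrite -Dv lv eq_sym mulf_eq0 signr_eq0 => /eqP.
  have : z \in G e by rewrite -qe Gq set22.
  by rewrite Ge => /set2P[]->; rewrite ?le ly ?mulr0.
have ly : l y = 0.
  apply: l0; have [_] := comp_connected F x; apply.
    exact: comp_cycle_verts sC v0C.
  apply: (comp_cycle_verts sC'); apply/bigcupP; exists e => //.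
  by rewrite Ge set22.
by apply/eqP; rewrite (closed_path_kills charK0 cp lks) ly mulr0.
Qed.

(** A component with a cycle has no other one, by applying inclusion both ways,
    and this cycle is odd because even cycles are dependent. *)
Lemma independent_odd_pseudoforest F : independent F -> odd_pseudoforest G F.
Proof.
move=> indF x; have [noC|] := EM (forall C, ~ cycle_in G C (comp_edges G F x)).
  by left; split=> //; apply: comp_connected.
move/existsNP=> [C /contrapT cC]; right; split.
  split; first exact: comp_connected.
  exists C; split=> // C' cC'; apply/eqP; rewrite eqEsubset.
  by rewrite (independent_cycle_sub indF cC cC') (independent_cycle_sub indF cC' cC).
move=> C' [cC' sC'].
by have [] := independent_odd_cycle indF (subset_trans sC' (comp_edges_sub F x)) cC'.
Qed.

Lemma walk_connect F x s u : walk G x s -> walk_edges s \subset F ->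
  u \in x :: unzip2 s -> connect (adj G F) x u.
Proof.
elim: s x => [|[e y] s IH] x /=; first by rewrite inE => _ _ /eqP->.
case/andP=> Ge ws /subsetP sF; rewrite inE => /orP[/eqP->//|us].
apply: connect_trans (IH y ws _ us); last first.
  by apply/subsetP=> q; rewrite inE => qs; apply: sF; rewrite !inE qs orbT.
by apply: connect1; apply/exists_inP; exists e => //; apply: sF; rewrite !inE eqxx.
Qed.

Lemma cycle_in_comp F C v : is_cycle G C -> C \subset F -> v \in verts G C ->
  cycle_in G C (comp_edges G F v).
Proof.
move=> cC sCF vC; split=> //; have [e [x [s [cp ev DC]]]] := cycle_at_vertex cC vC.
have [ws _ _ _] := cp.
have xu u : u \in x :: unzip2 s -> connect (adj G F) x u.
  by apply: walk_connect => //; apply: subset_trans sCF; rewrite DC subsetUr.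
apply/subsetP=> q qC; rewrite inE (subsetP sCF) //=; apply/subsetP=> u uq.
have : u \in verts G C by apply/bigcupP; exists q.
rewrite DC (closed_path_verts cp) !inE -in_cons => /xu; apply: connect_trans.
by rewrite adj_connect_sym xu // -ev; apply: mem_last.
Qed.

Lemma odd_pseudoforest_cycles F v C1 C2 : odd_pseudoforest G F ->
  cycle_in G C1 (comp_edges G F v) -> cycle_in G C2 (comp_edges G F v) ->
  C1 = C2 /\ odd #|C1|.
Proof.
move=> /(_ v)[[_ noC] /noC//|[[_ [C [_ uC]]] oC] c1 c2].
by rewrite -(uC _ c1) -(uC _ c2) (oC C) // (uC _ c1).
Qed.

(** Two disjoint odd cycles in a connected subgraph contradict the uniqueness of
    the cycle in a component. *)
Lemma odd_pseudoforest_no_even_circuit F Z :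
  odd_pseudoforest G F -> Z \subset F -> ~ even_circuit G Z.
Proof.
move=> pF sZF; have cyc C1 C2 v : is_cycle G C1 -> is_cycle G C2 ->
    C1 \subset F -> C2 \subset F -> v \in verts G C1 -> v \in verts G C2 -> C1 = C2.
  move=> c1 c2 s1 s2 v1 v2.
  by case: (@odd_pseudoforest_cycles F v C1 C2 pF); try exact: cycle_in_comp.
have nz C v : v \in verts G C -> exists e, e \in C.
  by case/bigcupP=> e eC _; exists e.
case=> [[cZ eZ]|[C1 [C2 [[c1 _] [c2 _] dC /eqP/cards1P[v vC] DZ]]]|].
- have [v vZ] := cycle_verts0 cZ; have cvZ := cycle_in_comp cZ sZF vZ.
  by have [_ oZ] := odd_pseudoforest_cycles pF cvZ cvZ; rewrite oZ in eZ.
- move: sZF; rewrite DZ subUset => /andP[s1 s2].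
  have /setIP[v1 v2] : v \in verts G C1 :&: verts G C2 by rewrite vC set11.
  have [e e1] := nz _ _ v1; have := disjointFr dC e1.
  by rewrite -(cyc C1 C2 v) // e1.
case=> C1 [C2 [P [x [y [[[c1 _] [c2 _]] dC [[s [ws es us DP]] _] [v1 v2] DZ]]]]].
have /setIP[_ x1] : x \in verts G P :&: verts G C1 by rewrite v1 set11.
have /setIP[_ y2] : y \in verts G P :&: verts G C2 by rewrite v2 set11.
move: sZF; rewrite DZ !subUset -andbA => /and3P[s1 sP s2].
have xy : connect (adj G F) x y.
  by apply: (walk_connect ws); rewrite -?DP // -es; apply: mem_last.
have Dxy : comp_edges G F y = comp_edges G F x.
  suff -> : comp_edges G F y = comp_edges G F x by [].
  rewrite /comp_edges; suff -> : comp_verts G F y = comp_verts G F x by [].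
  by apply/setP=> u; rewrite !inE (same_connect (adj_connect_sym F) xy).
have cx := cycle_in_comp c1 s1 x1.
have cy := cycle_in_comp c2 s2 y2; rewrite Dxy in cy.
have [D12 _] := odd_pseudoforest_cycles pF cx cy.
by have := disjointFr dC x1; rewrite D12 in y2 dC x1 *; have := disjointFr dC y2; rewrite y2.
Qed.

Lemma odd_pseudoforest_independent F : odd_pseudoforest G F <-> independent F.
Proof.
split; last exact: independent_odd_pseudoforest.
move=> pF e eF; apply/negP=> /(dependent_even_circuit charK0 eF)[Z [ecZ sZ]].
exact: odd_pseudoforest_no_even_circuit pF sZ ecZ.
Qed.

End PseudoforestsAreIndependent.

(** * Even activity is external activity *)

Section EvenActivityIsMatroidActivity.
Variables (K : fieldType) (charK0 : [pchar K] =i pred0).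
Variables (V : finType) (d : Order.disp_t) (E : finOrderType d) (G : mgraph V E).
Implicit Types (e f q : E) (F Z Q : {set E}).
Local Notation incidence := (@incidence K V E G).

(** A relation among the elements of F makes the least element of its support
    spanned by larger elements of F. *)
Lemma indepP F : reflect (independent K G F) (indep incidence F).
Proof.
apply: (iffP forall_inP) => [indF e eF|indF e eF]; last first.
  apply: contra (indF e eF); apply: spannedS; apply/subsetP=> f.
  by rewrite !inE => /andP[-> lt_ef]; rewrite andbT gt_eqF.
apply/negP=> /(dependent_relation eF)[w [we w0]].
have eP : [pred q in F | w q != 0] e by rewrite /= eF.
case: (@Order.TotalTheory.arg_minP _ _ E e _ id eP) => m /andP[mF wm] le_m.
 apply/negP: (indF m mF); rewrite negbK.
apply: spannedS (relation_spanned w0 mF wm); apply/subsetP=> q.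
rewrite !inE => /andP[/andP[qm qF] wq]; rewrite qF /= lt_neqAle eq_sym qm.
by rewrite le_m // inE qF.
Qed.

Lemma indep_odd_pseudoforest F : indep incidence F = (F \in odd_pseudoforests G).
Proof.
rewrite inE; apply/indepP/asboolP; by move/(odd_pseudoforest_independent charK0).
Qed.

(** An even circuit Z in F with e added carries a relation; it involves e because
    F is independent, so it expresses e by the rest of Z. Conversely, an even
    circuit in the dependent set formed by e and the larger elements of F must
    contain e, again because F is independent. *)
Lemma evenly_activeP F e : indep incidence F ->
  `[< evenly_active G F e >] = (e \in active incidence F).
Proof.
move=> /indepP indF; rewrite inE; apply/asboolP/andP => [[eF]|[eF]].
  case=> Z [ecZ sZ eZ min_e]; split=> //.
  have [g gZ gspan] := even_circuit_dependent charK0 ecZ.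
  have [w [wg w0]] := dependent_relation gZ gspan.
  have sub m : m \in Z -> m != e -> m \in F.
    by move=> /(subsetP sZ); rewrite in_setU1 => /orP[/eqP->|//]; rewrite eqxx.
  have we : w e != 0.
    apply/negP=> /eqP we; have ge : g != e by apply: contraNneq wg => ->; rewrite we.
    apply/negP: (indF g (sub g gZ ge)); rewrite negbK.
    apply: spannedS (relation_spanned w0 gZ wg); apply/subsetP=> q.
    rewrite !inE => /andP[/andP[qg qZ] wq]; rewrite qg sub //.
    by apply: contraNneq wq => ->; rewrite we.
  apply: spannedS (relation_spanned w0 eZ we); apply/subsetP=> q.
  rewrite !inE => /andP[/andP[qe qZ] _]; rewrite sub //=.
  by rewrite lt_neqAle eq_sym qe min_e.
move=> espan; split=> //.
have eQ : e \in e |: above e F by rewrite setU11.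
have : spanned incidence ((e |: above e F) :\ e) e.
  by rewrite setU1K // inE ltxx andbF.
case/(dependent_even_circuit charK0 eQ)=> Z [ecZ sZ].
have sAF : above e F \subset F by apply/subsetP=> q; rewrite inE => /andP[].
exists Z; split=> //.
- exact: subset_trans sZ (setUS _ sAF).
- apply/negPn/negP => eZ; apply: (independent_no_even_circuit charK0 indF _ ecZ).
  apply: subset_trans sAF; apply/subsetP=> q qZ; have := subsetP sZ q qZ.
  by rewrite in_setU1 => /orP[/eqP qe|//]; rewrite -qe qZ in eZ.
move=> q /(subsetP sZ); rewrite !inE => /orP[/eqP->//|/andP[_]].
exact: ltW.
Qed.

Lemma passive_even_activity F (k : nat) : indep incidence F ->
  ((even_activity G F)%:Z == #|~: F|%:Z - k%:Z) = (#|passive incidence F| == k).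
Proof.
move=> indF; have -> : even_activity G F = #|active incidence F|.
  by apply: eq_card => e; rewrite inE evenly_activeP.
have -> : #|~: F| = (#|active incidence F| + #|passive incidence F|)%N.
  rewrite -(cardsID (active incidence F) (~: F)); congr (_ + _)%N; apply: eq_card => e.
    rewrite in_setI inE; apply/andb_idl.
    by rewrite inE => /andP[].
  by rewrite in_setD /passive !in_setC in_setU negb_or andbC.
rewrite PoszD -addrA -[X in X == _]addr0 (inj_eq (addrI _)) eq_sym subr_eq0.
by [].
Qed.

End EvenActivityIsMatroidActivity.

(* |E \ F| - k is an integer difference: it may be negative. *)
Theorem theorem2p3 (K : fieldType) (charK0 : [pchar K] =i pred0)
    (V : finType) (d : Order.disp_t) (E : finOrderType d) (G : mgraph V E) :
  \dim (cplus K G) = #|odd_pseudoforests G| /\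
  forall k : nat,
    \dim (cplus_deg K G k) =
    #|[set F in odd_pseudoforests G |
        (even_activity G F)%:Z == #|~: F|%:Z - k%:Z]|.
Proof.
split=> [|k].
  rewrite (dim_vector_subalgebra charK0 (@incidence K V E G)).
  by apply: eq_card => F; rewrite inE (indep_odd_pseudoforest charK0).
rewrite (dim_vector_subalgebra_deg charK0 (@incidence K V E G)).
apply: eq_card => F; rewrite [LHS]inE [RHS]inE -(indep_odd_pseudoforest charK0).
by apply: andb_id2l => indF; rewrite (passive_even_activity charK0).
Qed.
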